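(* Let $K$ be an algebraically closed field of characteristic $p>0$, let $G$ be a cyclic group of order $p$ with generator $\sigma$, and let $V=\bigoplus_{j=1}^{l}V_{n_j}$ be a $G$-module over $K$ with $l\ge 1$ and $1<n_j\le p$ for all $j$, where $V_n$ is the indecomposable $G$-module of dimension $n$. Let $x_{i,j}$ ($1\le i\le n_j$, $1\le j\le l$) be the variables of $K[V]$ with $\sigma(x_{1,j})=x_{1,j}$ and $\sigma(x_{i,j})=x_{i,j}+x_{i-1,j}$ for $1<i\le n_j$. Let $I^{G}$ be the transfer ideal of $K[V]^{G}$. Let $M$ be a finitely generated graded nonzero $K[V]^{G}$-module on which the norms $N(x_{n_1,1}),\ldots,N(x_{n_l,l})$ form an $M$-regular sequence. Then \[ \operatorname{depth}(M)=\operatorname{grade}\bigl(I^{G},\,M/(N(x_{n_1,1}),\ldots,N(x_{n_l,l}))M\bigr)+l. \]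
   Context: $V_n$ (for $1\le n\le p$) is the $G$-module on which $\sigma$ acts by a single Jordan block of size $n$ with $1$'s on the diagonal. $K[V]:=S(V^{*})=K[x_{i,j}\mid 1\le i\le n_j,\ 1\le j\le l]$ is the polynomial ring with its standard grading, with $G$ acting by graded $K$-algebra automorphisms as specified in the claim, and $K[V]^{G}$ is the graded subalgebra of invariants. For $f\in K[V]$, the norm is $N(f)=\prod_{\tau\in G}\tau(f)$. The transfer map is $\operatorname{Tr}:K[V]\to K[V]^{G}$, $\operatorname{Tr}(f)=\sum_{i=0}^{p-1}\sigma^{i}(f)$, and the transfer ideal is its image $I^{G}=\operatorname{Tr}(K[V])$, a homogeneous ideal of $K[V]^{G}$. For a graded affine (finitely generated) $K$-algebra $R=\bigoplus_{d\ge 0}R_d$ with $R_0=K$, put $R_+=\bigoplus_{d\ge1}R_d$. Graded modules are of the form $M=\bigoplus_{d\ge 0}M_d$. For a finitely generated graded nonzero $R$-module $M$, a sequence of homogeneous elements $a_1,\dots,a_k\in R_+$ is $M$-regular if each $a_i$ is a nonzero divisor on $M/(a_1,\dots,a_{i-1})M$. For a homogeneous ideal $I\subseteq R_+$, $\operatorname{grade}(I,M)$ is the maximal length of an $M$-regular sequence lying in $I$, and $\operatorname{depth}(M)=\operatorname{grade}(R_+,M)$. *)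

(* Defs.v *)
From HB Require Import structures.
From mathcomp Require Import all_boot all_order all_algebra all_fingroup.
From mathcomp Require Import boolp.
From mathcomp Require Import mpoly.

Set Implicit Arguments.
Unset Strict Implicit.
Unset Printing Implicit Defensive.

Import GRing.Theory.
Local Open Scope ring_scope.
Local Open Scope quotient_scope.

Section SequenceQuotient.
Variables (R : comNzRingType) (M : lmodType R) (a : seq R).

(* (a_1, ..., a_k) M *)
Definition seq_submod : {pred M} := fun x =>
  `[< exists y : 'I_(size a) -> M, x = \sum_(i < size a) a`_i *: y i >].

Lemma seq_submod_closed : submod_closed seq_submod.
Proof.
split=> [|c x y /asboolP[u ->] /asboolP[v ->]]; apply/asboolP.
  by exists (fun=> 0); rewrite big1 // => i _; rewrite scaler0.
exists (fun i => c *: u i + v i); rewrite scaler_sumr -big_split /=.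
by apply: eq_bigr => i _; rewrite scalerDr !scalerA mulrC.
Qed.

HB.instance Definition _ :=
  GRing.isSubmodClosed.Build R M seq_submod seq_submod_closed.

(* M / (a_1, ..., a_k) M *)
Definition seq_quot : Type := Quotient.quot seq_submod.
HB.instance Definition _ := GRing.Zmodule.on seq_quot.

Definition seq_proj (x : M) : seq_quot := \pi_(Quotient.quot seq_submod) x.

Lemma seq_proj_eq x y : seq_proj x = seq_proj y <-> x - y \in seq_submod.
Proof. by rewrite Quotient.idealrBE; split=> /eqP. Qed.

Let quot_repr (v : seq_quot) : M :=
  generic_quotient.repr (v : Quotient.quot seq_submod).

Lemma seq_projK (v : seq_quot) : exists x, v = seq_proj x.
Proof. by exists (quot_repr v); rewrite /seq_proj /quot_repr reprK. Qed.

Lemma seq_projD x y : seq_proj (x + y) = seq_proj x + seq_proj y.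
Proof. by rewrite /seq_proj raddfD. Qed.

Definition seq_scale (r : R) (v : seq_quot) : seq_quot :=
  seq_proj (r *: quot_repr v).

Lemma seq_scale_proj r x : seq_scale r (seq_proj x) = seq_proj (r *: x).
Proof.
apply/seq_proj_eq; rewrite -scalerBr; apply: rpredZ.
by apply/seq_proj_eq; rewrite /seq_proj /quot_repr reprK.
Qed.

Lemma seq_scaleA b c v : seq_scale b (seq_scale c v) = seq_scale (b * c) v.
Proof. by have [x ->] := seq_projK v; rewrite !seq_scale_proj scalerA. Qed.

Lemma seq_scale1 : left_id 1 seq_scale.
Proof. by move=> v; have [x ->] := seq_projK v; rewrite seq_scale_proj scale1r. Qed.

Lemma seq_scaleDr : right_distributive seq_scale +%R.
Proof.
move=> c v w; have [x ->] := seq_projK v; have [y ->] := seq_projK w.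
by rewrite -seq_projD !seq_scale_proj scalerDr seq_projD.
Qed.

Lemma seq_scaleDl v : {morph seq_scale^~ v : b c / b + c}.
Proof.
move=> b c; have [x ->] := seq_projK v.
by rewrite !seq_scale_proj scalerDl seq_projD.
Qed.

HB.instance Definition _ := GRing.Zmodule_isLmodule.Build R seq_quot
  seq_scaleA seq_scale1 seq_scaleDr seq_scaleDl.

End SequenceQuotient.
Arguments seq_quot {R} M a.

Section Grade.
Variables (R : comNzRingType) (gr : nat -> {pred R}).

Definition direct_grading (U : zmodType) (h : nat -> {pred U}) : Prop :=
  [/\ forall d, zmod_closed (h d),
      forall x, exists n, exists2 c : nat -> U,
        forall d, c d \in h d & x = \sum_(d < n) c d
    & forall n (c : nat -> U), (forall d, c d \in h d) ->
        \sum_(d < n) c d = 0 -> forall d, (d < n)%N -> c d = 0].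

Definition graded_module (M : lmodType R) (h : nat -> {pred M}) : Prop :=
  direct_grading h /\
  forall i j r x, r \in gr i -> x \in h j -> r *: x \in h (i + j)%N.

Definition fin_gen (M : lmodType R) : Prop :=
  exists s : seq M, forall x : M,
    exists c : 'I_(size s) -> R, x = \sum_(i < size s) c i *: s`_i.

(* R_+, the sum of the R_d for d >= 1 *)
Definition irrelevant : {pred R} := fun r =>
  `[< exists n, exists2 c : nat -> R,
        forall d, c d \in gr d & r = \sum_(1 <= d < n) c d >].

Definition nonzerodiv (M : lmodType R) (r : R) : Prop :=
  forall x : M, r *: x = 0 -> x = 0.

Definition regular_seq (M : lmodType R) (a : seq R) : Prop :=
  (forall r, r \in a -> (exists d, r \in gr d) /\ r \in irrelevant) /\
  forall i, (i < size a)%N -> nonzerodiv (seq_quot M (take i a)) a`_i.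

Definition regular_seq_in (I : {pred R}) (M : lmodType R) (a : seq R) : Prop :=
  regular_seq M a /\ {subset a <= I}.

Definition is_grade (I : {pred R}) (M : lmodType R) (k : nat) : Prop :=
  (exists2 a, regular_seq_in I M a & size a = k) /\
  forall a, regular_seq_in I M a -> (size a <= k)%N.

Definition is_depth (M : lmodType R) (k : nat) : Prop :=
  is_grade irrelevant M k.

End Grade.

Record alg_action (K : comNzRingType) (gT : finGroupType) (A : comAlgType K) :=
  AlgAction {
    act_fun :> gT -> {lrmorphism A -> A};
    act1 : forall f, act_fun 1%g f = f;
    actM : forall g h f, act_fun (g * h)%g f = act_fun g (act_fun h f)
  }.

Section Invariants.
Variables (K : comNzRingType) (gT : finGroupType) (A : comAlgType K).
Variable rho : alg_action gT A.

Definition invariant : {pred A} := fun f => [forall g, rho g f == f].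

Lemma invariant_subalg : subalg_closed invariant.
Proof.
split=> [|c x y /forallP xP /forallP yP|x y /forallP xP /forallP yP];
  apply/forallP=> g; first by rewrite rmorph1.
- by rewrite linearP /= (eqP (xP g)) (eqP (yP g)).
- by rewrite rmorphM /= (eqP (xP g)) (eqP (yP g)).
Qed.

HB.instance Definition _ :=
  GRing.isSubalgClosed.Build K A invariant invariant_subalg.

Record inv_ring := InvRing { inv_val :> A; _ : inv_val \in invariant }.

HB.instance Definition _ := [isSub for inv_val].
HB.instance Definition _ := [Choice of inv_ring by <:].
HB.instance Definition _ := [SubChoice_isSubComNzRing of inv_ring by <:].
HB.instance Definition _ := [SubZmodule_isSubLmodule of inv_ring by <:].
HB.instance Definition _ :=
  [SubNzRing_SubLmodule_isSubLalgebra of inv_ring by <:].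

Lemma norm_invariant (f : A) : \prod_(g : gT) rho g f \in invariant.
Proof.
apply/forallP=> h; apply/eqP; rewrite rmorph_prod [RHS](reindex_inj (mulgI h)).
by apply: eq_bigr => g _; rewrite actM.
Qed.

Definition norm (f : A) : inv_ring := InvRing (norm_invariant f).

Definition transfer (p : nat) (s : gT) (f : A) : A :=
  \sum_(i < p) rho (s ^+ i)%g f.

(* The image of the transfer; its values are invariant when s is a generator of
   the group and p its order. *)
Definition transfer_ideal (p : nat) (s : gT) : {pred inv_ring} := fun r =>
  `[< exists f, inv_val r = transfer p s f >].

End Invariants.
Arguments transfer_ideal {K gT A} rho p s.

Section PolynomialRing.
Variables (K : fieldType) (l : nat) (n : 'I_l -> nat).

Definition nvars : nat := #|{: {j : 'I_l & 'I_(n j)}}|.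

(* x_{i,j} with i counted from 1 to n_j; outside this range the value is
   irrelevant. *)
Definition xvar (i : nat) (j : 'I_l) : {mpoly K[nvars]} :=
  if insub i.-1 is Some k
  then 'X_(enum_rank (Tagged (fun j => 'I_(n j)) (k : 'I_(n j)))) else 0.

Definition inv_grading (gT : finGroupType)
    (rho : alg_action gT {mpoly K[nvars]}) (d : nat) : {pred inv_ring rho} :=
  fun r => inv_val r \is d.-homog.

End PolynomialRing.
Arguments xvar K {l} n i j.
Arguments inv_grading {K l n gT} rho d.

(* Main.v *)
Require Import Defs.
From HB Require Import structures.
From mathcomp Require Import all_boot all_order all_algebra all_fingroup.
From mathcomp Require Import cyclic ring.
From mathcomp Require Import boolp.
From mathcomp Require Import mpoly.
Import GRing.Theory.
Local Open Scope ring_scope.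

(** Write R for the invariant ring, R_+ for its irrelevant ideal, I for the
transfer ideal, and a for the sequence of the norms N(x_{n_j,j}).  The point of
the statement is that R_+ is the radical of I + (a).  On M/aM the norms act by
zero, so there I detects regular elements as well as R_+ does; hence
grade(I, M/aM) = depth(M/aM), and depth(M/aM) = depth(M) - l because a is
M-regular.

Geometry ([transfer_norm_radical]).  For f in K[V], interpolation on the orbit
of f writes the product of the f - g(f), g <> 1, as a K[V]-linear combination
of traces ([trace_separation]).  For f = x_{i+1,j} every factor is a nonzero
multiple of x_{i,j} modulo x_{1,j}, ..., x_{i-1,j}; by induction on i all
x_{i,j} with i < n_j are nilpotent modulo I K[V], and then N(x_{n_j,j}) takes
care of the last variable of the block ([block_radical]).  So every element of
R_+ has a power in (I + (a)) K[V], and the norm of a polynomial with these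
generators as variables brings a further power back into I + (a)
([extension_contract]).

Regular sequences.  All sequences live on the fixed module M: a quotient of M
is a submodule A, and z is regular on M/A when z u in A forces u in A.  The key
is the exchange theorem [rseq_exchange]: if M has a regular sequence of length
k+1 and x is regular, then M/xM has one of length k.  It makes all maximal
regular sequences equally long.  It rests on [exists_nzd]: an M/A on which no
nonzero vector is killed by all the candidates has a regular candidate.
Instead of prime avoidance this uses that K is infinite: if z is regular, then
z + c y is regular for all but finitely many scalars c ([nzd_pencil]), so
regular elements of different modules can be merged into one.  Homogeneity is
kept by replacing z and y by powers of the same degree.

Finiteness.  The polynomial ring is built from K by adjoining the coefficients
of the orbit polynomials of the variables, a Hilbert basis argument, and then
the variables themselves, which are integral over these coefficients.  So
K[V] satisfies the ascending chain condition already for submodules over R,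
hence so do R and M ([inv_ring_noeth], [fin_gen_noeth]).  Lengths of regular
sequences on M are bounded since a maximal submodule of the form (s)M, s
regular, cannot be enlarged, while (s)M <> M by the graded Nakayama lemma
([addms_proper]). *)

Set Implicit Arguments.
Unset Strict Implicit.
Unset Printing Implicit Defensive.

(** * Ascending chains of submodules *)

Local Notation full := (fun _ => True).

Lemma subrACA (V : zmodType) (a b c d : V) : (a - b) - (c - d) = (a - c) - (b - d).
Proof. by rewrite !opprD !opprK addrACA. Qed.

Section Noetherian.
Variable B : comNzRingType.
Implicit Types (S : B -> Prop) (V : lmodType B).

(** Submodules over the subring generated by S, for a mere set S of scalars:
the subring over which chains are considered changes throughout the
finiteness proof, the ambient module does not. *)
Definition stable V S (X : V -> Prop) : Prop :=
  [/\ X 0, forall x y, X x -> X y -> X (x - y)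
    & forall s x, S s -> X x -> X (s *: x)].

(** The chain condition is relative to N, but the chains are not required to
lie in N: one may intersect them with N. *)
Definition noeth V S (N : V -> Prop) : Prop :=
  forall X : nat -> V -> Prop,
    (forall k, stable S (X k)) -> (forall k x, X k x -> X k.+1 x) ->
    exists k, forall j x, N x -> X j x -> X k x.

Section Stable.
Variables (V : lmodType B) (S : B -> Prop) (X : V -> Prop).
Hypothesis sX : stable S X.

Lemma stable0 : X 0. Proof. by case: sX. Qed.

Lemma stableB x y : X x -> X y -> X (x - y).
Proof. by case: sX => _ sB _; exact: sB. Qed.

Lemma stableN x : X x -> X (- x).
Proof. by move=> Xx; rewrite -sub0r; apply: stableB => //; exact: stable0. Qed.

Lemma stableD x y : X x -> X y -> X (x + y).
Proof. by move=> Xx Xy; rewrite -[y]opprK; apply: stableB => //; exact: stableN. Qed.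

Lemma stableZ s x : S s -> X x -> X (s *: x).
Proof. by case: sX => _ _ sZ; exact: sZ. Qed.

Lemma stable_sum I (r : seq I) (P : pred I) (F : I -> V) :
  (forall i, P i -> X (F i)) -> X (\sum_(i <- r | P i) F i).
Proof.
by move=> XF; apply: (big_ind X) => //; [exact: stable0 | exact: stableD].
Qed.

Lemma stableBl x y : X (x - y) -> X y -> X x.
Proof. by move=> Xxy Xy; rewrite -(subrK y x); exact: stableD. Qed.

Lemma stableBr x y : X (x - y) -> X x -> X y.
Proof. by move=> Xxy Xx; rewrite -(subKr x y); exact: stableB. Qed.

End Stable.

Lemma stable_sub V S S' (X : V -> Prop) :
  (forall s, S' s -> S s) -> stable S X -> stable S' X.
Proof. by move=> SS [X0 XB XZ]; split=> // s x /SS; exact: XZ. Qed.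

Lemma noeth_sub V S S' (N : V -> Prop) :
  (forall s, S s -> S' s) -> noeth S N -> noeth S' N.
Proof. by move=> SS noN X sX; apply: noN => k; exact: stable_sub SS (sX k). Qed.

Lemma chain_le T (X : nat -> T -> Prop) :
  (forall k x, X k x -> X k.+1 x) ->
  forall j k x, (j <= k)%N -> X j x -> X k x.
Proof.
move=> Xmon j k x /subnK <-; elim: (k - j)%N => [//|d IH] Xx.
by rewrite addSn; apply/Xmon/IH.
Qed.

(** Otherwise dependent choice would produce a strictly increasing chain. *)
Lemma noeth_max V S (P : (V -> Prop) -> Prop) :
  noeth S (fun _ : V => True) -> (forall X, P X -> stable S X) ->
  (exists X, P X) ->
  exists2 X, P X & forall Y, P Y -> (forall x, X x -> Y x) ->
    forall x, Y x -> X x.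
Proof.
move=> noV Pst [X0 PX0]; apply: contrapT => nomax.
have /choice[next nextP] : forall X : {X | P X}, exists Y : {X | P X},
    (forall x, sval X x -> sval Y x) /\ exists2 x, sval Y x & ~ sval X x.
  case=> X PX; apply: contrapT => noY; apply: nomax; exists X => // Y PY XY x Yx.
  apply: contrapT => nXx; apply: noY; exists (exist _ Y PY).
  by split=> //; exists x.
pose c k := iter k next (exist _ X0 PX0).
have [|k x|k kP] := noV (fun k => sval (c k)).
- by move=> k; apply: Pst; exact: svalP.
- by case: (nextP (c k)) => + _; exact.
case: (nextP (c k)) => _ [x Yx]; apply; exact: (kP k.+1).
Qed.

(** The extension N + f(N2): a chain X is determined by its intersections with N
and by the submodules of those u in N2 for which f u lies in X_k + N. *)
Lemma noeth_ext V V2 S (f : V2 -> V) (N : V -> Prop) (N2 : V2 -> Prop) :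
  {morph f : x y / x - y} -> (forall s x, f (s *: x) = s *: f x) ->
  stable S N -> noeth S N -> noeth S N2 ->
  noeth S (fun x => exists2 u, N2 u & N (x - f u)).
Proof.
move=> fB fZ sN noN noN2 X sX Xmon.
pose L k u := exists2 x, X k x & N (x - f u).
have f0 : f 0 = 0 by rewrite -(subrr 0) fB subrr.
have [|k u [x /Xmon Xx Nx]|k2 k2P] := noN2 L; [|by exists x|].
  move=> k; split.
  - by exists 0; [exact: stable0 (sX k) | rewrite f0 subr0; exact: stable0 sN].
  - move=> u v [x Xx Nx] [y Xy Ny]; exists (x - y); first exact: (stableB (sX k)).
    by rewrite fB subrACA; exact: (stableB sN).
  - move=> s u Ss [x Xx Nx]; exists (s *: x); first exact: (stableZ (sX k)).
    by rewrite fZ -scalerBr; exact: (stableZ sN).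
have [k1 k1P] := noN X sX Xmon.
exists (maxn k1 k2) => j x [u N2u Nx] Xx.
have [x' Xx' Nx'] : L k2 u by apply: (k2P j) => //; exists x.
apply: (stableBl (sX _) (y := x')).
  apply: (chain_le Xmon (leq_maxl _ _)).
  apply: (k1P (maxn j k2)).
    by have := stableB sN Nx Nx'; rewrite opprB addrA subrK.
  by apply: (stableB (sX _)); [apply: (chain_le Xmon) Xx | apply: (chain_le Xmon) Xx'];
     rewrite ?leq_maxl ?leq_maxr.
by apply: (chain_le Xmon) Xx'; rewrite leq_maxr.
Qed.

(** N + t N + ... + t^(n-1) N *)
Definition powspan V (t : B) (N : V -> Prop) n (x : V) : Prop :=
  exists2 c : nat -> V, forall i, N (c i) & x = \sum_(i < n) t ^+ i *: c i.

Lemma powspan_stable V S t (N : V -> Prop) n :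
  stable S N -> stable S (powspan t N n).
Proof.
move=> sN; split.
- exists (fun=> 0) => [i|]; first exact: (stable0 sN).
  by rewrite big1 // => i _; rewrite scaler0.
- move=> x y [c Nc ->] [d Nd ->]; exists (fun i => c i - d i) => [i|].
    exact: (stableB sN).
  by rewrite -sumrB; apply: eq_bigr => i _; rewrite scalerBr.
- move=> s x Ss [c Nc ->]; exists (fun i => s *: c i) => [i|].
    exact: (stableZ sN).
  by rewrite scaler_sumr; apply: eq_bigr => i _; rewrite !scalerA mulrC.
Qed.

Lemma powspanS V t (N : V -> Prop) n x :
  powspan t N n.+1 x <-> exists2 u, N u & powspan t N n (x - t ^+ n *: u).
Proof.
split=> [[c Nc ->]|[u Nu [c Nc xE]]].
  by exists (c n) => //; exists c => //; rewrite big_ord_recr addrK.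
exists (fun i => if (i < n)%N then c i else u) => [i|]; first by case: ifP.
rewrite big_ord_recr /= ltnn -(subrK (t ^+ n *: u) x) xE; congr (_ + _).
by apply: eq_bigr => i _; rewrite ltn_ord.
Qed.

Lemma powspan_le V S t (N : V -> Prop) n m x :
  stable S N -> (n <= m)%N -> powspan t N n x -> powspan t N m x.
Proof.
move=> sN; apply: (chain_le (X := powspan t N)) => k y Fy.
by apply/powspanS; exists 0; [exact: (stable0 sN) | rewrite scaler0 subr0].
Qed.

Lemma powspan_mulX V S t (N : V -> Prop) n x :
  stable S N -> powspan t N n x -> powspan t N n.+1 (t *: x).
Proof.
move=> sN [c Nc ->]; exists (fun i => if i is i.+1 then c i else 0) => [[|i]|//].
- exact: (stable0 sN).
- by [].
- rewrite big_ord_recl scaler0 add0r scaler_sumr.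
  by apply: eq_bigr => i _; rewrite scalerA -exprS.
Qed.

Lemma powspan_noeth V S t (N : V -> Prop) n :
  stable S N -> noeth S N -> noeth S (powspan t N n).
Proof.
move=> sN noN; elim: n => [|n IH].
  move=> X sX _; exists 0%N => j x [c _ ->] _.
  by rewrite big_ord0; exact: (stable0 (sX _)).
have noext : noeth S (fun x => exists2 u, N u & powspan t N n (x - t ^+ n *: u)).
  apply: (noeth_ext (f := fun u => t ^+ n *: u)) => //.
  - by move=> x y; rewrite scalerBr.
  - by move=> s x; rewrite !scalerA mulrC.
  - exact: powspan_stable.
by move=> X sX Xmon; have [k kP] := noext X sX Xmon;
   exists k => j x /powspanS; exact: kP.
Qed.

(** Hilbert's basis theorem, in the form: if N is Noetherian over S, then N[t]
is Noetherian over S[t].  As usual one looks at the submodules L_n of leading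
coefficients of the elements of degree n; the sum need not be direct. *)
Lemma hilbert_step V S t (N : V -> Prop) :
  stable S N -> noeth S N ->
  let St s := S s \/ s = t in
  let Nt x := exists n, powspan t N n x in
  stable St Nt /\ noeth St Nt.
Proof.
move=> sN noN St Nt; have sF n := powspan_stable t n sN; split.
  split; first by exists 0%N; exact: (stable0 (sF _)).
    move=> x y [n Fx] [m Fy]; exists (maxn n m).
    by apply: (stableB (sF _)); [apply: (powspan_le sN) Fx | apply: (powspan_le sN) Fy];
       rewrite ?leq_maxl ?leq_maxr //; exact: sN.
  move=> s x [Ss|->] [n Fx]; first by exists n; exact: (stableZ (sF n)).
  by exists n.+1; exact: (powspan_mulX sN).
move=> X sX Xmon.
have sXS k : stable S (X k) by apply: stable_sub (sX k); left.
pose L n k u := N u /\ exists2 x, X k x & powspan t N n (x - t ^+ n *: u).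
have sL n k : stable S (L n k).
  split.
  - split; first exact: (stable0 sN).
    by exists 0; [exact: (stable0 (sX k)) | rewrite scaler0 subr0; exact: (stable0 (sF n))].
  - move=> u v [Nu [x Xx Fx]] [Nv [y Xy Fy]]; split; first exact: (stableB sN).
    exists (x - y); first exact: (stableB (sX k)).
    by rewrite scalerBr subrACA; exact: (stableB (sF n)).
  - move=> s u Ss [Nu [x Xx Fx]]; split; first exact: (stableZ sN).
    exists (s *: x); first exact: (stableZ (sXS k)).
    by have := stableZ (sF n) Ss Fx; rewrite scalerBr !scalerA mulrC.
have Lk n k u : L n k u -> L n k.+1 u.
  by move=> [Nu [x /Xmon Xx Fx]]; split=> //; exists x.
have Ln n k u : L n k u -> L n.+1 k u.
  move=> [Nu [x Xx Fx]]; split=> //; exists (t *: x).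
    by apply: (stableZ (sX k)) Xx; right.
  by have := powspan_mulX sN Fx; rewrite scalerBr scalerA -exprS.
have Lmon n n' k k' u : (n <= n')%N -> (k <= k')%N -> L n k u -> L n' k' u.
  move=> nn' kk' /(chain_le (Lk n) kk').
  by apply: (chain_le (X := fun n => L n k')) nn' => m v; exact: Ln.
(* The diagonal chain L_k(X_k) takes care of all degrees n >= k0 at once. *)
have [k0 k0P] := noN (fun k => L k k) (fun k => sL k k)
  (fun k u Lu => Lk _ _ _ (Ln _ _ _ Lu)).
have [k1 k1P] : exists k1, forall n j u, (n < k0)%N -> L n j u -> L n k1 u.
  elim: (k0) => [|m [k1 k1P]]; first by exists 0%N.
  have [k kP] := noN (L m) (sL m) (Lk m).
  exists (maxn k1 k) => n j u; rewrite ltnS leq_eqVlt => /predU1P[->|nm] Lu.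
    by apply: (Lmon _ _ _ _ _ _ _ (kP j u _ Lu)); rewrite ?leq_maxr //; case: Lu.
  by apply: (Lmon _ _ _ _ _ _ _ (k1P n j u nm Lu)); rewrite ?leq_maxl.
have LP n j u : L n j u -> L n (maxn k0 k1) u.
  move=> Lu; have [nk0|k0n] := ltnP n k0.
    by apply: (Lmon _ _ _ _ _ _ _ (k1P n j u nk0 Lu)); rewrite ?leq_maxr.
  have Lu' : L (maxn n j) (maxn n j) u.
    by apply: (Lmon _ _ _ _ _ _ _ Lu); rewrite ?leq_maxl ?leq_maxr.
  by apply: (Lmon _ _ _ _ _ _ _ (k0P _ u _ Lu')); rewrite ?leq_maxl //; case: Lu.
exists (maxn k0 k1) => j x [n Fx] Xx.
have {Xx} := chain_le Xmon (leq_maxl j (maxn k0 k1)) Xx.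
(* Two nested submodules with the same leading coefficients are equal: cancel
   the leading term and induct on the degree. *)
elim: n x Fx => [|n IH] x.
  by move=> [c _ ->]; rewrite big_ord0 => _; exact: (stable0 (sX _)).
move=> /powspanS[u Nu Fx] Xx.
have [|_ [y Xy Fy]] := LP n (maxn j (maxn k0 k1)) u; first by split=> //; exists x.
apply: (stableBl (sX _) (y := y)) => //; apply: IH.
  by have := stableB (sF n) Fx Fy; rewrite opprB addrA subrK.
by apply: (stableB (sX _)) Xx _; apply: (chain_le Xmon) Xy => //; exact: leq_maxr.
Qed.

Lemma hilbert V S (N : V -> Prop) (ts : seq B) :
  stable S N -> noeth S N ->
  exists N' : V -> Prop, [/\ forall x, N x -> N' x,
    stable (fun s => S s \/ s \in ts) N' & noeth (fun s => S s \/ s \in ts) N'].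
Proof.
elim: ts S N => [|t ts IH] S N sN noN.
  exists N; split=> //; first by apply: stable_sub sN => s [].
  by apply: noeth_sub noN => s; left.
have [sN1 noN1] := hilbert_step t sN noN.
have [N' [NN' sN' noN']] := IH _ _ sN1 noN1.
exists N'; split.
- move=> x Nx; apply: NN'; exists 1%N; exists (fun=> x) => //.
  by rewrite big_ord1 expr0 scale1r.
- apply: stable_sub sN' => s; rewrite inE.
  by case=> [?|/predU1P[?|?]]; [left; left|left; right|right].
- apply: noeth_sub noN' => s; rewrite inE.
  by case=> [[?|->]|->]; [left|right; rewrite eqxx|right; rewrite orbT].
Qed.

(** Adjoining an element x that is integral over S: the first p powers of x
suffice, so the chain condition over S itself is kept, and the new module is
stable under x and under whatever scalars the old one was stable under. *)
Lemma noeth_integral V S x p (a : nat -> B) (N : V -> Prop) :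
  (forall k, S (a k)) -> x ^+ p = \sum_(k < p) a k * x ^+ k ->
  stable S N -> noeth S N ->
  [/\ forall u, N u -> (0 < p)%N -> powspan x N p u,
     stable S (powspan x N p),
     forall u, powspan x N p u -> powspan x N p (x *: u),
     noeth S (powspan x N p) &
     forall y, (forall u, N u -> N (y *: u)) ->
       forall u, powspan x N p u -> powspan x N p (y *: u)].
Proof.
move=> Sa xp sN noN; have sF := powspan_stable x p sN.
split=> //.
- move=> u Nu p_gt0; apply: (powspan_le (n := 1) sN) => //.
  by exists (fun=> u) => //; rewrite big_ord1 expr0 scale1r.
- move=> u /(powspan_mulX sN)/powspanS[v Nv Fu].
  apply: (stableBl sF Fu); rewrite xp; exists (fun k => a k *: v) => [k|].
    exact: (stableZ sN).
  by rewrite scaler_suml; apply: eq_bigr => k _; rewrite scalerA mulrC.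
- exact: powspan_noeth.
- move=> y Ny u [c Nc ->]; exists (fun i => y *: c i) => [i|]; first exact: Ny.
  by rewrite scaler_sumr; apply: eq_bigr => k _; rewrite !scalerA mulrC.
Qed.

End Noetherian.

(** * Regular sequences on quotients of a fixed module *)

Local Notation submod := (stable full).

Section RegularSequences.
Variables (R : comNzRingType) (M : lmodType R).

(** z is a nonzero divisor on U/A *)
Definition nzd_on (U A : M -> Prop) (z : R) : Prop :=
  forall u, U u -> A (z *: u) -> A u.

(** A + z M *)
Definition addm (z : R) (A : M -> Prop) (x : M) : Prop :=
  exists m, A (x - z *: m).

Lemma submodZ (A : M -> Prop) r x : submod A -> A x -> A (r *: x).
Proof. by move=> sA; exact: (stableZ sA). Qed.

Lemma addm_submod z A : submod A -> submod (addm z A).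
Proof.
move=> sA; split.
- by exists 0; rewrite scaler0 subr0; exact: (stable0 sA).
- move=> x y [m Am] [n An]; exists (m - n).
  by rewrite scalerBr subrACA; exact: (stableB sA).
- move=> r x _ [m Am]; exists (r *: m).
  by rewrite scalerA mulrC -scalerA -scalerBr; exact: submodZ.
Qed.

Lemma sub_addm z A x : A x -> addm z A x.
Proof. by move=> Ax; exists 0; rewrite scaler0 subr0. Qed.

Lemma addm_scale z A m : submod A -> addm z A (z *: m).
Proof. by move=> sA; exists m; rewrite subrr; exact: (stable0 sA). Qed.

Lemma addmC y z A : addm y (addm z A) = addm z (addm y A).
Proof.
by apply/funext => x; apply/propext; split=> -[m [n Amn]]; exists n, m;
   rewrite addrAC.
Qed.

Lemma nzd_on_exp U A z k : submod U -> nzd_on U A z -> nzd_on U A (z ^+ k).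
Proof.
move=> sU nz; elim: k => [|k IH] u Uu; first by rewrite expr0 scale1r.
by rewrite exprS -scalerA => /nz-/(_ (submodZ _ sU Uu))/IH-/(_ Uu).
Qed.

(** The half of the permutability of regular sequences that holds without any
Nakayama argument. *)
Lemma nzd_addm_swap y z A :
  submod A -> nzd_on full A y -> nzd_on full (addm y A) z ->
  nzd_on full (addm z A) y.
Proof.
move=> sA ny nz m _ [m' Am].
have [|w Aw] := nz m' I.
  by exists m; rewrite -opprB; exact: (stableN sA).
exists w; apply: ny => //.
have := stableD sA Am (submodZ z sA Aw).
by rewrite !scalerBr addrA subrK !scalerA mulrC.
Qed.

(** s is a regular sequence on M/A with entries in E *)
Fixpoint rseq (E : R -> Prop) (A : M -> Prop) (s : seq R) : Prop :=
  if s is z :: s' then [/\ E z, nzd_on full A z & rseq E (addm z A) s'] else True.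

Definition addms (A : M -> Prop) (s : seq R) : M -> Prop :=
  foldl (fun A z => addm z A) A s.

Lemma addms_submod A s : submod A -> submod (addms A s).
Proof. by elim: s A => //= z s IH A /(addm_submod z)/IH. Qed.

Lemma sub_addms A s x : A x -> addms A s x.
Proof. by elim: s A => //= z s IH A Ax; apply/IH/sub_addm. Qed.

Lemma rseq_cat E A s t : rseq E A (s ++ t) <-> rseq E A s /\ rseq E (addms A s) t.
Proof.
elim: s A => [|z s IH] A /=; first by split=> [|[]].
by split=> [[Ez nz /IH[]]|[[Ez nz rs] rt]] //; split=> //; apply/IH.
Qed.

Section Noetherian.
Variables (K : fieldType) (iota : {rmorphism K -> R}).
Hypothesis K_infinite : forall s : seq K, exists c, c \notin s.
Hypothesis noethR : noeth full (fun _ : R^o => True).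
Hypothesis noethM : noeth full (fun _ : M => True).

(** If infinitely many c_0, c_1, ... were bad, with u_i in U outside A killed by
z + c_i y, the submodules of those x that are killed by the product of the
z + c_i y, i < k, would form a strictly increasing chain: on u_k the element
z acts as - c_k y, so the product acts as a nonzero scalar times a power of y;
then a power of z would kill u_k as well. *)
Lemma nzd_pencil U A z y : submod U -> submod A -> nzd_on U A z ->
  exists bad : seq K, forall c, c \notin bad -> nzd_on U A (z + iota c * y).
Proof.
move=> sU sA nz; apply: contrapT => nobad.
have /choice[f fP] : forall bad : seq K, exists cu : K * M,
    [/\ cu.1 \notin bad, U cu.2, A ((z + iota cu.1 * y) *: cu.2) & ~ A cu.2].
  move=> bad; apply: contrapT => nocu; apply: nobad; exists bad => c cbad u Uu Au.
  by apply: contrapT => nAu; apply: nocu; exists (c, u).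
pose w (s : seq K) := \prod_(c <- s) (z + iota c * y).
pose bad k := iter k (fun s => (f s).1 :: s) [::].
have [k|k x|k kP] := noethM (X := fun k x => A (w (bad k) *: x)).
- split; first by rewrite scaler0; exact: (stable0 sA).
    by move=> x x' Ax Ax'; rewrite scalerBr; exact: (stableB sA).
  by move=> r x _ Ax; rewrite scalerA mulrC -scalerA; exact: submodZ.
- by rewrite /w /= big_cons -scalerA; exact: submodZ.
have [cbad Uu Au nAu] := fP (bad k).
apply: nAu; have {kP} := kP k.+1 (f (bad k)).2 I.
rewrite {1}/w /= big_cons mulrC -scalerA => /(_ (submodZ _ sA Au)).
move: (f (bad k)) cbad Uu Au => [c u] /=; elim: (bad k) => [|c' s IH].
  by rewrite /w big_nil scale1r.
rewrite inE negb_or => /andP[cc' cs] Uu Au; rewrite /w big_cons -/(w s) -scalerA => Aw.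
apply: IH => //; set v := w s *: u in Aw *.
have Uv : U v by exact: submodZ.
have Av : A ((z + iota c * y) *: v) by rewrite scalerA mulrC -scalerA; exact: submodZ.
clearbody v; have Ayv : A (y *: v).
  have : A (iota (c - c')^-1 *: (iota (c - c') *: (y *: v))).
    apply: submodZ => //; have := stableB sA Av Aw.
    by rewrite -scalerBl opprD addrACA subrr add0r -mulrBl -rmorphB scalerA.
  by rewrite scalerA -rmorphM mulVf ?subr_eq0 // rmorph1 scale1r.
apply: nz => //; have := stableB sA Av (submodZ (iota c) sA Ayv).
by rewrite scalerA -scalerBl addrK.
Qed.

(** For the homogeneous elements of positive degree in an ideal, the exponents
equalize the degrees of z and y. *)
Definition pencil_closed (E : R -> Prop) : Prop :=
  forall z y, E z -> E y -> exists a b : nat, forall c, E (z ^+ a + iota c * y ^+ b).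

Lemma finitely_many_bad k (P : nat -> K -> Prop) :
  (forall i, (i < k)%N -> exists bad : seq K, forall c, c \notin bad -> P i c) ->
  exists bad : seq K, forall c, c \notin bad -> forall i, (i < k)%N -> P i c.
Proof.
elim: k => [|k IH] Pk; first by exists [::].
have [b bP] := IH (fun i ik => Pk i (ltnW ik)); have [b' b'P] := Pk k (ltnSn k).
exists (b ++ b') => c; rewrite mem_cat negb_or => /andP[cb cb'] i.
by rewrite ltnS leq_eqVlt => /predU1P[->|]; [exact: b'P | exact: bP].
Qed.

(** Merging regular elements of finitely many modules: a general member of the
pencil of z and y is regular wherever z is, and wherever y is. *)
Lemma nzd_common E (U A : nat -> M -> Prop) k z0 :
  pencil_closed E -> E z0 ->
  (forall i, (i < k)%N -> submod (U i)) -> (forall i, (i < k)%N -> submod (A i)) ->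
  (forall i, (i < k)%N -> exists2 z, E z & nzd_on (U i) (A i) z) ->
  exists2 z, E z & forall i, (i < k)%N -> nzd_on (U i) (A i) z.
Proof.
move=> Ep Ez0; elim: k => [|k IH] sU sA zP; first by exists z0.
have [||i ik|z Ez nz] := IH.
- by move=> i ik; apply: sU; exact: ltnW.
- by move=> i ik; apply: sA; exact: ltnW.
- by apply: zP; exact: ltnW.
have [y Ey ny] := zP k (ltnSn k).
have [a [b Eab]] := Ep z y Ez Ey.
have [bad badP] : exists bad : seq K, forall c, c \notin bad -> forall i,
    (i < k)%N -> nzd_on (U i) (A i) (z ^+ a + iota c * y ^+ b).
  apply: finitely_many_bad => i ik.
  apply: nzd_pencil; [apply: sU|apply: sA|]; rewrite ?ltnS ?(ltnW ik) //.
  by apply: nzd_on_exp; [apply: sU; exact: ltnW | exact: nz].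
have [bad' badP'] := nzd_pencil (z ^+ a) (sU k (ltnSn k)) (sA k (ltnSn k))
  (nzd_on_exp (k := b) (sU k (ltnSn k)) ny).
have [c] := K_infinite (0 :: bad ++ map (fun c => c^-1) bad').
rewrite inE mem_cat !negb_or => /and3P[c0 cb cb'].
exists (z ^+ a + iota c * y ^+ b) => // i.
rewrite ltnS leq_eqVlt => /predU1P[->|]; last exact: badP.
(* On the last module y leads the pencil: divide by c. *)
have : nzd_on (U k) (A k) (y ^+ b + iota c^-1 * z ^+ a).
  by apply: badP'; apply: contra cb' => cb'; rewrite -[c]invrK map_f.
move=> nk u Uu Au; apply: nk => //.
have := submodZ (iota c^-1) (sA k (ltnSn k)) Au.
by rewrite scalerA mulrDr mulrA -rmorphM mulVf // rmorph1 mul1r addrC.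
Qed.

(** For w in W/A with maximal annihilator, every scalar that does not kill w is
regular on R w: this replaces the choice of an associated prime. *)
Lemma max_annihilator (W A : M -> Prop) : submod W -> submod A ->
  (exists2 w, W w & ~ A w) ->
  exists w, [/\ W w, ~ A w &
    forall y, ~ A (y *: w) -> forall r, A (y *: (r *: w)) -> A (r *: w)].
Proof.
move=> sW sA [w0 Ww0 nAw0].
pose P (X : R^o -> Prop) := exists w, [/\ W w, ~ A w & X = fun r => A (r *: w)].
have [X||X [w [Ww nAw XE]] wmax] := noeth_max (P := P) noethR.
- move=> [w [Ww nAw ->]]; split; first by rewrite scale0r; exact: (stable0 sA).
    by move=> r r' Ar Ar'; rewrite scalerBl; exact: (stableB sA).
  by move=> s r _ Ar; rewrite -scalerA; exact: submodZ.
- by exists (fun r => A (r *: w0)), w0.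
exists w; subst X; split=> // y nAy r Ary.
apply: (wmax (fun r => A (r *: (y *: w)))).
- by exists (y *: w); split=> //; exact: submodZ.
- by move=> s As; rewrite scalerA mulrC -scalerA; exact: submodZ.
- by rewrite scalerA mulrC -scalerA.
Qed.

(** Take U maximal among the submodules that admit a regular z in E.  If z is not
regular on all of M/A, its kernel contains a cyclic submodule R w on which
some y in E is regular; it meets U trivially, so merging z and y gives an
element of E regular on the larger U + R w. *)
Lemma exists_nzd E A z0 : pencil_closed E -> E z0 -> submod A ->
  (forall u, ~ A u -> exists2 y, E y & ~ A (y *: u)) ->
  exists2 z, E z & nzd_on full A z.
Proof.
move=> Ep Ez0 sA socA.
pose P U := [/\ submod U, forall x, A x -> U x & exists2 z, E z & nzd_on U A z].
have [U []||U [sU AU [z Ez nz]] Umax] := noeth_max (P := P) noethM => //.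
  by exists A; split=> //; exists z0.
apply: contrapT => nonz.
pose W x := A (z *: x).
have sW : submod W.
  split; rewrite /W; first by rewrite scaler0; exact: (stable0 sA).
    by move=> x y Ax Ay; rewrite scalerBr; exact: (stableB sA).
  by move=> r x _ Ax; rewrite scalerA mulrC -scalerA; exact: submodZ.
have [|w [Ww nAw wmax]] := max_annihilator sW sA.
  apply: contrapT => noW; apply: nonz; exists z => // u _ Au.
  by apply: contrapT => nAu; apply: noW; exists u.
have [y Ey nAy] := socA w nAw.
pose W' x := exists r, A (x - r *: w).
have sW' : submod W'.
  split; first by exists 0; rewrite scale0r subr0; exact: (stable0 sA).
    move=> x x' [r Ax] [r' Ax']; exists (r - r').
    by rewrite scalerBl subrACA; exact: (stableB sA).
  by move=> s x _ [r Ax]; exists (s * r); rewrite -scalerA -scalerBr; exact: submodZ.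
have AW' x : A x -> W' x by move=> Ax; exists 0; rewrite scale0r subr0.
have W'z x : W' x -> A (z *: x).
  move=> [r Ax]; apply: (stableBl sA (y := z *: (r *: w))).
    by rewrite -scalerBr; exact: submodZ.
  by rewrite scalerA mulrC -scalerA; exact: submodZ.
have ny : nzd_on W' A y.
  move=> x [r Ax] Ayx; apply: (stableBl sA Ax); apply: wmax nAy _ _.
  by apply: (stableBr sA (x := y *: x)) => //; rewrite -scalerBr; exact: submodZ.
have [t Et tP] : exists2 t, E t & forall i, (i < 2)%N ->
    nzd_on (if i == 0%N then U else W') A t.
  apply: (nzd_common Ep Ez0) => -[|[|//]] _ //; first by exists z.
  by exists y.
pose V x := exists2 u, U u & W' (x - u).
have sV : submod V.
  split; first by exists 0; rewrite ?subr0; [exact: (stable0 sU)|exact: (stable0 sW')].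
    move=> x x' [u Uu Wx] [u' Uu' Wx']; exists (u - u'); first exact: (stableB sU).
    by rewrite subrACA; exact: (stableB sW').
  move=> s x _ [u Uu Wx]; exists (s *: u); first exact: submodZ.
  by rewrite -scalerBr; exact: submodZ.
have W'V x : W' x -> V x by move=> Wx; exists 0; rewrite ?subr0 //; exact: (stable0 sU).
have UW' x : U x -> W' x -> A x by move=> Ux /W'z; exact: nz.
apply: (nAw); apply: (UW'); last by exists 1; rewrite scale1r subrr; exact: (stable0 sA).
apply: (Umax V); last by apply: W'V; exists 1; rewrite scale1r subrr; exact: (stable0 sA).
  split=> // [x Ax|]; first exact/W'V/AW'.
  exists t => // x [u Uu Wx] Atx.
  have tWx := submodZ t sW' Wx; have tUu := submodZ t sU Uu.
  have Atu : A (t *: u).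
    apply: (UW') => //; apply: (stableBr sW' (x := t *: x)); last exact: AW'.
    by rewrite -scalerBr.
  have Au := tP 0%N isT u Uu Atu.
  apply: (stableBl sA (y := u)) => //; apply: (tP 1%N isT) => //.
  by rewrite scalerBr; exact: (stableB sA).
by move=> x Ux; exists x; rewrite // subrr; exact: (stable0 sW').
Qed.

(** Induction on the length.  Write s = y, y2, ...; the socles of M/xM and M/yM
are isomorphic (u corresponds to v when y u = x v modulo A), so the first
vanishes since y2 is regular on M/yM.  Hence there is z regular on
M, M/xM and M/yM, and the induction hypothesis leads from M/yM to M/(y,z)M,
that is from M/zM, where y is regular, to M/(z,x)M. *)
Lemma rseq_exchange E A x k s : pencil_closed E -> submod A ->
  rseq E A s -> size s = k.+1 -> E x -> nzd_on full A x ->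
  exists2 s', rseq E (addm x A) s' & size s' = k.
Proof.
move=> Ep; elim: k A x s => [|k IH] A x s sA; first by exists [::].
case: s => [//|y [//|y2 s]] [Ey ny [Ey2 ny2 rs]] [sz] Ex nx.
have sAx := addm_submod x sA; have sAy := addm_submod y sA.
have [z1 Ez1 nz1] : exists2 z, E z & nzd_on full (addm x A) z.
  apply: (exists_nzd Ep Ex) => // u nAu; apply: contrapT => noE.
  have Eu e : E e -> addm x A (e *: u).
    by move=> Ee; apply: contrapT => nAe; apply: noE; exists e.
  have [v Av] := Eu y Ey.
  have nAv : ~ addm y A v.
    move=> [w Aw]; apply: nAu; exists w; apply: ny => //.
    have := stableD sA Av (submodZ x sA Aw).
    by rewrite !scalerBr addrA subrK !scalerA mulrC.
  apply/nAv/ny2 => //; have [m Am] := Eu y2 Ey2; exists m; apply: nx => //.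
  have := stableB sA (submodZ y sA Am) (submodZ y2 sA Av).
  rewrite !scalerBr !scalerA [y * y2]mulrC opprB addrC addrA subrK.
  by rewrite [y2 * x]mulrC [y * x]mulrC.
pose L i := nth A [:: addm x A; addm y A; A] i.
have [z Ez zP] : exists2 z, E z & forall i, (i < 3)%N -> nzd_on full (L i) z.
  apply: (nzd_common Ep Ex).
  - by move=> i _; split.
  - by case=> [|[|[|]]].
  - by case=> [|[|[|]]] // _; [exists z1 | exists y2 | exists x].
have [nzx nzy nzA] : [/\ nzd_on full (addm x A) z, nzd_on full (addm y A) z & nzd_on full A z].
  by split; [exact: (zP 0%N) | exact: (zP 1%N) | exact: (zP 2%N)].
have sAz := addm_submod z sA.
have [|s3 rs3 sz3] := IH (addm y A) z (y2 :: s) sAy _ (congr1 S sz) Ez nzy; first by split.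
have [|||s4 rs4 sz4] := IH (addm z A) x (y :: s3) sAz _ _ Ex.
- by rewrite addmC in rs3; split=> //; exact: nzd_addm_swap.
- by rewrite /= sz3.
- exact: nzd_addm_swap.
by exists (z :: s4); rewrite /= ?sz4 //; split=> //; rewrite addmC.
Qed.

Lemma rseq_exchange_seq E A s t : pencil_closed E -> submod A ->
  rseq E A s -> rseq E A t -> (size s <= size t)%N ->
  exists2 t', rseq E (addms A s) t' & size t' = (size t - size s)%N.
Proof.
move=> Ep; elim: s A t => [|x s IH] A t sA /=; first by exists t; rewrite ?subn0.
move=> [Ex nx rs] rt st; have szt : size t = (size t).-1.+1.
  by rewrite prednK // (leq_trans _ st).
have [t1 rt1 szt1] := rseq_exchange Ep sA rt szt Ex nx.
have [|t2 rt2 szt2] := IH _ t1 (addm_submod x sA) rs rt1.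
  by rewrite szt1 -ltnS -szt.
by exists t2 => //; rewrite szt2 szt1 -subn1 -subnDA.
Qed.

End Noetherian.
End RegularSequences.

(** * Depth and grade *)

Section Translation.
Variable R : comNzRingType.

Lemma addmsP (M : lmodType R) (A : M -> Prop) (a : seq R) x :
  addms A a x <->
  exists y : 'I_(size a) -> M, A (x - \sum_(i < size a) a`_i *: y i).
Proof.
elim: a A => [|z a IH] A /=.
  by split=> [Ax|[y]]; [exists (fun=> 0)|]; rewrite big_ord0 subr0.
rewrite IH; split=> [[y [m Am]]|[y Ay]].
  exists (fun i => oapp y m (unlift ord0 i)); rewrite big_ord_recl /= unlift_none /=.
  rewrite opprD addrA addrAC (eq_bigr (fun i : 'I_(size a) => a`_i *: y i)) // => i _.
  by rewrite liftK.
exists (fun i => y (lift ord0 i)), (y ord0).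
by move: Ay; rewrite big_ord_recl opprD addrA addrAC.
Qed.

(** The submodule (a)M is A + (a)M for A = 0. *)
Lemma seq_submodP (M : lmodType R) (a : seq R) x :
  x \in @seq_submod R M a <-> addms (fun x => x = 0) a x.
Proof.
rewrite addmsP; split=> [/asboolP[y ->]|[y /eqP]]; first by exists y; rewrite subrr.
by rewrite subr_eq0 => /eqP xE; apply/asboolP; exists y.
Qed.

Lemma zero_submod (M : lmodType R) : submod (fun x : M => x = 0).
Proof.
by split=> // [x y -> ->|s x _ ->]; rewrite ?subrr ?scaler0.
Qed.

Lemma rseqP (M : lmodType R) (E : R -> Prop) (A : M -> Prop) a :
  rseq E A a <-> (forall r, r \in a -> E r) /\
    forall i, (i < size a)%N -> nzd_on full (addms A (take i a)) a`_i.
Proof.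
elim: a A => [|z a IH] A /=; first by split.
split=> [[Ez nz /IH[Ea na]]|[Ea na]].
  split=> [r|[|i]]; [|by []|exact: na].
  by rewrite inE => /predU1P[->//|/Ea].
split; [by apply: Ea; rewrite mem_head | exact: (na 0%N) | apply/IH].
split=> [r ra|i ia]; first by apply: Ea; rewrite inE ra orbT.
exact: (na i.+1).
Qed.

Definition pos_homog (gr : nat -> {pred R}) (r : R) : Prop :=
  (exists d, r \in gr d) /\ r \in irrelevant gr.

(** A module N that is a quotient of M by f is studied through the preimages in
M of its submodules. *)
Section Quotient.
Variables (M N : lmodType R) (f : M -> N).
Hypotheses (fB : {morph f : x y / x - y}) (fZ : forall r x, f (r *: x) = r *: f x).
Hypothesis f_surj : forall v, exists x, f x = v.

Lemma addms_comp (B : N -> Prop) a :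
  addms (fun x => B (f x)) a = fun x => addms B a (f x).
Proof.
elim: a B => //= z a IH B; rewrite -IH; congr addms.
apply/funext => x; apply/propext; split=> [[m Bm]|[v Bv]].
  by exists (f m); rewrite -fZ -fB.
by have [m mv] := f_surj v; exists m; rewrite fB fZ mv.
Qed.

Lemma nonzerodiv_quot r a :
  nonzerodiv (seq_quot N a) r <-> nzd_on full (addms (fun x => f x = 0) a) r.
Proof.
rewrite (addms_comp (fun v => v = 0)).
have seq_proj0 v : seq_proj a v = 0 <-> addms (fun v => v = 0) a v.
  by rewrite -seq_submodP -{2}[v]subr0 -seq_proj_eq /seq_proj raddf0.
split=> [nr x _|nr v].
  by rewrite fZ -!seq_proj0 => rx; apply: nr; rewrite -seq_scale_proj in rx.
have [w ->] := seq_projK v; have [x <-] := f_surj w.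
rewrite -[_ *: _]/(seq_scale _ _) seq_scale_proj -fZ !seq_proj0; exact: nr.
Qed.

Lemma regular_seqP gr a :
  regular_seq gr N a <-> rseq (pos_homog gr) (fun x => f x = 0) a.
Proof.
rewrite rseqP; split=> -[Ea na]; split=> // i ia.
  exact/nonzerodiv_quot/na.
exact/nonzerodiv_quot/na.
Qed.

Lemma regular_seq_inP gr (I : {pred R}) a :
  regular_seq_in gr I N a <->
  rseq (fun r => pos_homog gr r /\ r \in I) (fun x => f x = 0) a.
Proof.
split=> [[/regular_seqP/rseqP[Ea na] aI]|/rseqP[Ea na]].
  by apply/rseqP; split=> // r ra; split; [exact: Ea | exact: aI].
split; last by move=> r /Ea[].
by apply/regular_seqP/rseqP; split=> // r /Ea[].
Qed.

End Quotient.

(** Depth versus grade for an ideal I that has the same radical as R_+ on M/aM *)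
Section Depth.
Variables (K : fieldType) (iota : {rmorphism K -> R}).
Variables (M : lmodType R) (gr : nat -> {pred R}) (I : {pred R}).
Hypothesis K_infinite : forall s : seq K, exists c, c \notin s.
Hypothesis noethR : noeth full (fun _ : R^o => True).
Hypothesis noethM : noeth full (fun _ : M => True).

Let E := pos_homog gr.
Let EI r := E r /\ r \in I.
Hypothesis E_pencil : pencil_closed iota E.
Hypothesis EI_pencil : pencil_closed iota EI.
Hypothesis EI0 : EI 0.
Let zero (x : M) := x = 0.
Hypothesis proper : forall s, rseq E zero s -> exists x, ~ addms zero s x.

(** A regular s with (s)M maximal cannot be extended: a further regular z would
satisfy zM inside (s)M, and regularity would give M = (s)M.  By exchange no regular sequence is
longer. *)
Lemma rseq_bounded :
  exists2 s, rseq E zero s & forall t, rseq E zero t -> (size t <= size s)%N.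
Proof.
have s0 := zero_submod M.
pose P X := exists2 s, rseq E zero s & X = addms zero s.
have [X [s _ ->]||_ [s rs ->] smax] := noeth_max (P := P) noethM.
- exact: (addms_submod s s0).
- by exists zero, [::].
exists s => // t rt; rewrite leqNgt; apply/negP => st.
have [[|z t'] /= rt' szt'] :=
    rseq_exchange_seq K_infinite noethR noethM E_pencil s0 rs rt (ltnW st).
  by move: st; rewrite -subn_gt0 -szt'.
case: rt' => Ez nz _; have [x nx] := proper rs; apply: nx; apply: (nz) => //.
apply: (smax (addm z (addms zero s))).
- exists (rcons s z); last by rewrite /addms foldl_rcons.
  by rewrite -cats1; apply/rseq_cat.
- by move=> y; exact: sub_addm.
- by apply: addm_scale; exact: (addms_submod s s0).
Qed.

Variable a : seq R.
Hypothesis rega : rseq E zero a.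

Hypothesis R_pos_nilpotent : forall (A : M -> Prop) u, submod A ->
  (forall x, addms zero a x -> A x) -> (forall y, EI y -> A (y *: u)) ->
  forall y, E y -> exists m, A (y ^+ m *: u).

(** A vector killed by I is killed by powers of all elements of R_+; among these
vectors, one with maximal annihilator is killed by R_+ itself.  So a regular
element of R_+ on M/A forces one in I, and exchange lowers the length. *)
Lemma rseq_EI (A : M -> Prop) s : submod A -> (forall x, addms zero a x -> A x) ->
  rseq E A s -> exists2 t, rseq EI A t & size t = size s.
Proof.
move: {2}(size s) (erefl (size s)) => k; elim: k A s => [|k IH] A s szs sA aA rs.
  by exists [::].
have [z [Ez Iz] nz] : exists2 z, EI z & nzd_on full A z.
  apply: (exists_nzd K_infinite noethR noethM EI_pencil EI0 sA) => u nAu.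
  apply: contrapT => noy; pose W w := forall y, EI y -> A (y *: w).
  have sW : submod W.
    split=> [y _|x x' Wx Wx' y Ey|r x _ Wx y Ey].
    - by rewrite scaler0; exact: (stable0 sA).
    - by rewrite scalerBr; apply: (stableB sA); [exact: Wx | exact: Wx'].
    - by rewrite scalerA mulrC -scalerA; apply: submodZ => //; exact: Wx.
  have Wu : W u.
    by move=> y Ey; apply: contrapT => nAy; apply: noy; exists y.
  have [|w [Ww nAw wmax]] := max_annihilator noethR sW sA; first by exists u.
  case: s szs rs => // y s _ [Ey ny _].
  have {}ny : ~ A (y *: w) by move=> /(ny _ Logic.I).
  have [m] := R_pos_nilpotent sA aA Ww Ey.
  elim: m => [|m IHm]; first by rewrite expr0 scale1r.
  by rewrite exprS -scalerA => /(wmax _ ny _)/IHm.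
have [s' rs' szs'] := rseq_exchange K_infinite noethR noethM E_pencil sA rs szs Ez nz.
have [|t rt szt] := IH _ s' szs' (addm_submod z sA) _ rs'.
  by move=> x /aA; exact: sub_addm.
by exists (z :: t); rewrite /= ?szt ?szs'.
Qed.

Lemma depth_grade : exists depthM gradeI : nat,
  [/\ is_depth gr M depthM, is_grade gr I (seq_quot M a) gradeI
    & depthM = (gradeI + size a)%N].
Proof.
have s0 := zero_submod M; have sa := addms_submod a s0.
have [s rs smax] := rseq_bounded.
have regM t : regular_seq_in gr (irrelevant gr) M t <-> rseq E zero t.
  rewrite (regular_seq_inP (f := id)) //; last by move=> v; exists v.
  rewrite !rseqP; split=> -[Et nt]; split=> // r /Et; first by case.
  by move=> Er; split=> //; case: Er.
have regQ t : regular_seq_in gr I (seq_quot M a) t <-> rseq EI (addms zero a) t.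
  rewrite (regular_seq_inP (f := @seq_proj R M a)).
  - suff -> : (fun x : M => seq_proj a x = 0) = addms zero a by [].
    apply/funext => x; apply/propext.
    by rewrite -seq_submodP -{2}[x]subr0 -seq_proj_eq /seq_proj raddf0.
  - by move=> x y; rewrite /seq_proj raddfB.
  - by move=> r x; rewrite -seq_scale_proj.
  - by move=> v; have [x ->] := seq_projK v; exists x.
exists (size s), (size s - size a)%N; split; last by rewrite subnK // smax.
- split; first by exists s => //; apply/regM.
  by move=> t /regM; exact: smax.
- split.
    have [t rt szt] := rseq_exchange_seq K_infinite noethR noethM E_pencil s0
      rega rs (smax _ rega).
    have [//|t' rt' szt'] := rseq_EI sa _ rt.
    by exists t'; [apply/regQ | rewrite szt'].
  move=> t /regQ/rseqP[EIt nt].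
  rewrite -(leq_add2r (size a)) subnK ?smax // addnC -size_cat; apply: smax.
  by apply/rseq_cat; split=> //; apply/rseqP; split=> // r /EIt[].
Qed.

End Depth.
End Translation.

(** * Noetherianity of the invariant ring *)

Lemma fin_gen_noeth (R : comNzRingType) (M : lmodType R) :
  noeth full (fun _ : R^o => True) -> fin_gen M -> noeth full (fun _ : M => True).
Proof.
move=> noR [s sP].
pose N k (x : M) := exists c : nat -> R, x = \sum_(i < k) c i *: s`_i.
suff noN k : noeth full (N k).
  move=> X sX Xmon; have [k kP] := noN (size s) X sX Xmon.
  exists k => j x _; apply: kP; have [c ->] := sP x.
  exists (fun i => oapp c 0 (insub i)).
  by apply: eq_bigr => i _; rewrite insubT /= ?ltn_ord // => lt; congr (c _ *: _); apply: val_inj.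
have sN j : stable full (N j).
  split; first by exists (fun=> 0); rewrite big1 // => i _; rewrite scale0r.
    move=> _ _ [c ->] [d ->]; exists (fun i => c i - d i).
    by rewrite -sumrB; apply: eq_bigr => i _; rewrite scalerBl.
  move=> r _ _ [c ->]; exists (fun i => r * c i).
  by rewrite scaler_sumr; apply: eq_bigr => i _; rewrite scalerA.
elim: k => [|k IH].
  move=> X sX _; exists 0%N => j _ [c ->] _; rewrite big_ord0; exact: (stable0 (sX _)).
move=> X sX Xmon.
have [||k' k'P] := noeth_ext (f := fun r : R^o => (r : R) *: s`_k) _ _ (sN k) IH noR sX Xmon.
- by move=> x y; rewrite scalerBl.
- by move=> r x; rewrite scalerA.
exists k' => j x [c xE]; apply: k'P; exists (c k) => //.
by exists c; rewrite xE big_ord_recr addrK.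
Qed.

Section InvariantRing.
Variables (K : fieldType) (A : comAlgType K) (gT : finGroupType).
Variable rho : alg_action gT A.

(** the orbit polynomial, which makes f integral over the invariants *)
Definition charpol (f : A) : {poly A} := \prod_(g : gT) ('X - (rho g f)%:P).

Lemma charpol_inv f k : (charpol f)`_k \in Defs.invariant rho.
Proof.
apply/forallP => h; rewrite -coef_map; apply/eqP.
suff -> : map_poly (rho h) (charpol f) = charpol f by [].
rewrite rmorph_prod /charpol [RHS](reindex_inj (mulgI h)).
by apply: eq_bigr => g _; rewrite Defs.actM rmorphB /= map_polyX map_polyC.
Qed.

Lemma charpol_root f :
  f ^+ #|gT| = \sum_(k < #|gT|) - (charpol f)`_k * f ^+ k.
Proof.
have : (charpol f).[f] = 0.
  rewrite horner_prod (bigD1 1%g) //= Defs.act1 hornerXsubC subrr mul0r //.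
have szP : size (charpol f) = #|gT|.+1.
  by rewrite /charpol size_prod_XsubC /index_enum -enumT -cardE.
have /monicP : charpol f \is monic by exact: monic_prod_XsubC.
rewrite lead_coefE szP horner_coef szP big_ord_recr /= => ->; rewrite mul1r addrC.
by move/eqP; rewrite addr_eq0 -sumrN => /eqP ->; apply: eq_bigr => k _; rewrite mulNr.
Qed.

(** Start from the scalars, adjoin the coefficients of the orbit polynomials of
the generators by Hilbert's theorem, then the generators, which are integral
over them.  The result is all of A, Noetherian over the subring generated by
these coefficients; every R-submodule of R is a submodule of A over it. *)
Lemma inv_ring_noeth (xs : seq A) :
  (forall P : A -> Prop, P 1 -> (forall f g, P f -> P g -> P (f + g)) ->
     (forall c f, P f -> P (c *: f)) ->
     (forall x f, x \in xs -> P f -> P (x * f)) -> forall f, P f) ->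
  noeth full (fun _ : (inv_ring rho)^o => True).
Proof.
move=> A_gen.
pose S0 (f : A) := exists c : K, f = c%:A.
pose N0 (f : A^o) := S0 f.
have sN0 : stable S0 N0.
  split; first by exists 0; rewrite scale0r.
    by move=> _ _ [c ->] [d ->]; exists (c - d); rewrite scalerBl.
  by move=> _ _ [c ->] [d ->]; exists (c * d); rewrite -[LHS]/(c%:A * d%:A) mulr_algl scalerA.
have noN0 : noeth S0 N0.
  move=> X sX Xmon.
  have [[k [c c0 Xc]]|noX] := pselect (exists k, exists2 c : K, c != 0 & X k c%:A).
    exists k => j _ [d ->] _; rewrite -[d](divfK c0) -scalerA -mulr_algl.
    by apply: (stableZ (sX k)) Xc; exists (d / c).
  exists 0%N => j _ [c ->] Xc; have [->|c0] := eqVneq c 0.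
    by rewrite scale0r; exact: (stable0 (sX _)).
  by case: noX; exists j, c.
pose ts : seq A := [seq - (charpol x)`_k | x <- xs, k <- iota 0 #|gT|].
have [N1 [N01 sN1 noN1]] := hilbert ts sN0 noN0.
set S1 := fun s => _ in sN1 noN1.
have S1t x k : x \in xs -> S1 (if (k < #|gT|)%N then - (charpol x)`_k else 0).
  move=> xxs; case: ifP => kp; last by left; exists 0; rewrite scale0r.
  by right; apply/allpairsP; exists (x, k); rewrite mem_iota.
have [N2 [N12 sN2 noN2 xN2]] : exists N2 : A^o -> Prop,
    [/\ forall f, N1 f -> N2 f, stable S1 N2, noeth S1 N2 &
      forall x f, x \in xs -> N2 f -> N2 (x *: f)].
  have : {subset xs <= xs} by [].
  elim: {1 3}xs => [|x ys IH] yxs; first by exists N1.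
  have [|N2 [N12 sN2 noN2 xN2]] := IH.
    by move=> y yys; apply: yxs; rewrite inE yys orbT.
  have xxs : x \in xs by apply: yxs; rewrite mem_head.
  have [|F1 F2 F3 F4 F5] := noeth_integral (fun k => S1t x k xxs) _ sN2 noN2 (x := x) (p := #|gT|).
    by rewrite charpol_root; apply: eq_bigr => k _; rewrite ltn_ord.
  eexists; split; [| exact: F2 | exact: F4 |].
    by move=> f /N12/F1; apply; apply/card_gt0P; exists 1%g.
  by move=> w f; rewrite inE => /predU1P[->|wvs]; [exact: F3 | apply: F5 => u; exact: xN2].
have N2all : forall f, N2 f.
  apply: A_gen.
  - by apply/N12/N01; exists 1; rewrite scale1r.
  - by move=> f g; exact: (stableD sN2).
  - move=> c f Nf; rewrite -mulr_algl; apply: (stableZ sN2) => //.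
    by left; exists c.
  - by move=> x f; exact: xN2.
move=> X sX Xmon.
pose Y k (f : A^o) := exists2 r : inv_ring rho, X k r & f = inv_val r.
have [k|k f [r /Xmon Xr ->]|k kP] := noN2 Y.
- split.
  + by exists 0 => //; exact: (stable0 (sX k)).
  + move=> _ _ [r Xr ->] [r' Xr' ->]; exists (r - r'); first exact: (stableB (sX k)).
    by [].
  + move=> s _ Ss [r Xr ->].
    have sinv : s \in Defs.invariant rho.
      case: Ss => [[c ->]|]; first by rewrite rpredZ // rpred1.
      by move=> /allpairsP[[v i] [_ _ ->]]; rewrite rpredN charpol_inv.
    by exists (InvRing sinv * r); first exact: (stableZ (sX k) (s := InvRing sinv)).
- by exists r.
- exists k => j r _ Xr; have [|r' Xr' rr'] := kP j (inv_val r) (N2all _).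
    by exists r.
  by rewrite (@val_inj _ _ (inv_ring rho) r r' rr').
Qed.

End InvariantRing.

Lemma mpoly_gen (K : fieldType) N (P : {mpoly K[N]} -> Prop) :
  P 1 -> (forall f g, P f -> P g -> P (f + g)) -> (forall c f, P f -> P (c *: f)) ->
  (forall x f, x \in [seq 'X_v | v : 'I_N] -> P f -> P (x * f)) -> forall f, P f.
Proof.
move=> P1 PD PZ PX f; rewrite [f]mpolyE; apply: (big_ind P) => //.
  by rewrite -(scale0r 1); exact: PZ.
move=> m _; apply: PZ; rewrite mpolyXE_id -[\prod_(i < N) _]mulr1.
apply: (big_ind (fun h => forall g, P g -> P (h * g))) => // [g Pg|h h' Hh Hh' g Pg|i _ g Pg].
- by rewrite mul1r.
- by rewrite -mulrA; exact/Hh/Hh'.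
- elim: (m i) => [|k IH]; first by rewrite mul1r.
  by rewrite exprS -mulrA; apply: PX; rewrite // image_f.
Qed.

(** * Traces, norms and the radical of the transfer ideal *)

Section Transfer.
Variables (K : fieldType) (A : comAlgType K) (gT : finGroupType).
Variable rho : alg_action gT A.
Local Notation R := (inv_ring rho).

Lemma inv_val_act (r : R) g : rho g (inv_val r) = inv_val r.
Proof. by case: r => f /= /forallP/(_ g)/eqP. Qed.

Lemma inv_val_inj : injective (@inv_val K gT A rho).
Proof. exact: val_inj. Qed.

Lemma inv_valM (r s : R) : inv_val (r * s) = inv_val r * inv_val s.
Proof. by []. Qed.

Lemma inv_valX (r : R) k : inv_val (r ^+ k) = inv_val r ^+ k.
Proof. by elim: k => // k IH; rewrite !exprS inv_valM IH. Qed.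

Lemma inv_val_sum I (s : seq I) P (F : I -> R) :
  inv_val (\sum_(i <- s | P i) F i) = \sum_(i <- s | P i) inv_val (F i).
Proof. exact: (big_morph (@inv_val K gT A rho)). Qed.

Lemma inv_val_prod I (s : seq I) P (F : I -> R) :
  inv_val (\prod_(i <- s | P i) F i) = \prod_(i <- s | P i) inv_val (F i).
Proof. exact: (big_morph (@inv_val K gT A rho)). Qed.

Lemma trace_invariant f : \sum_(g : gT) rho g f \in Defs.invariant rho.
Proof.
apply/forallP => h; apply/eqP; rewrite raddf_sum [RHS](reindex_inj (mulgI h)).
by apply: eq_bigr => g _; rewrite Defs.actM.
Qed.

Definition trace (f : A) : R := InvRing (trace_invariant f).

Variable J : R^o -> Prop.
Hypothesis sJ : stable full J.

(** the extended ideal J A *)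
Definition extension (f : A) : Prop :=
  exists2 l : seq (R * A), forall x, x \in l -> J x.1
    & f = \sum_(x <- l) inv_val x.1 * x.2.

Lemma extension_sum I (r : seq I) (P : pred I) (F : I -> A) :
  (forall i, P i -> extension (F i)) -> extension (\sum_(i <- r | P i) F i).
Proof.
move=> EF; apply: (big_ind extension) => //; first by exists [::]; rewrite ?big_nil.
move=> _ _ [l Jl ->] [l' Jl' ->]; exists (l ++ l'); rewrite ?big_cat // => x.
by rewrite mem_cat => /orP[/Jl|/Jl'].
Qed.

Lemma extensionM f g : extension g -> extension (f * g).
Proof.
move=> [l Jl ->]; rewrite mulr_sumr big_seq.
apply: extension_sum => x /Jl Jx; exists [:: (x.1, f * x.2)] => [y|].
  by rewrite inE => /eqP ->.
by rewrite big_seq1 mulrCA.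
Qed.

Lemma extension_val r : J r -> extension (inv_val r).
Proof.
move=> Jr; exists [:: (r, 1)] => [x|]; first by rewrite inE => /eqP ->.
by rewrite big_seq1 mulr1.
Qed.

(** If r = sum_i j_i a_i with the j_i in J, then r^|G| is the product over g of the
sum_i j_i g(a_i): the value at the j_i of a homogeneous polynomial Phi of
degree |G| > 0 whose coefficients are invariant. *)
Lemma extension_contract r : extension (inv_val r) -> J (r ^+ #|gT|).
Proof.
move=> [l Jl rE]; pose x i := tnth (in_tuple l) i.
pose Phi : {mpoly A[size l]} :=
  \prod_(g : gT) \sum_(i < size l) (rho g (x i).2)%:MP * 'X_i.
have Phi_inv m : Phi@_m \in Defs.invariant rho.
  apply/forallP => h; rewrite -mcoeff_map_mpoly; apply/eqP.
  suff -> : map_mpoly (rho h) Phi = Phi by [].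
  rewrite rmorph_prod /Phi [RHS](reindex_inj (mulgI h)).
  apply: eq_bigr => g _; rewrite raddf_sum; apply: eq_bigr => i _.
  by rewrite Defs.actM /= rmorphM /= map_mpolyX map_mpolyC.
have Phi0 : Phi@_0%MM = 0.
  rewrite rmorph_prod (bigD1 1%g) //= raddf_sum big1 ?mul0r // => i _.
  by rewrite /= mcoeffCM mcoeffX mnm1_eq0 mulr0.
have rPhi : Phi.@[fun i => inv_val (x i).1] = inv_val r ^+ #|gT|.
  rewrite rmorph_prod -prodr_const; apply: eq_bigr => g _.
  rewrite -(inv_val_act r g) rE !raddf_sum [RHS]big_tnth; apply: eq_bigr => i _.
  by rewrite /= mevalM mevalC mevalXU rmorphM /= inv_val_act mulrC.
pose c m : R := InvRing (Phi_inv m).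
have -> : r ^+ #|gT| = \sum_(m <- msupp Phi) c m * \prod_i (x i).1 ^+ m i.
  apply: inv_val_inj; rewrite inv_valX -rPhi mevalE inv_val_sum.
  apply: eq_bigr => m _; rewrite inv_valM inv_val_prod; congr (_ * _).
  by apply: eq_bigr => i _; rewrite inv_valX.
rewrite big_seq; apply: (stable_sum sJ) => m msup.
have [i mi] : exists i, m i != 0%N.
  apply/existsP; rewrite -negb_forall; apply: contraL msup => /forallP m0.
  suff -> : m = 0%MM by rewrite mcoeff_msupp Phi0 eqxx.
  by apply/mnmP => i; rewrite mnm0E; exact/eqP.
rewrite (bigD1 i) //= mulrCA -(prednK (n := m i)) ?lt0n // exprS mulrAC -mulrA mulrC.
by apply: (stableZ sJ) => //; apply: Jl; exact: mem_tnth.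
Qed.

(** Let Q(X) be the product of the X - g(f), g <> 1.  It vanishes at h(f) for
h <> 1, so Q(f) is the sum of the Q(h(f)) over all h, and expanding Q in powers
of X turns this sum into a combination of the traces of the powers of f. *)
Lemma trace_separation f : (forall k, J (trace (f ^+ k))) ->
  extension (\prod_(g : gT | g != 1%g) (f - rho g f)).
Proof.
move=> Jtr; pose Q : {poly A} := \prod_(g : gT | g != 1%g) ('X - (rho g f)%:P).
have Qf z : Q.[z] = \prod_(g : gT | g != 1%g) (z - rho g f).
  by rewrite horner_prod; apply: eq_bigr => g _; rewrite hornerXsubC.
have -> : \prod_(g : gT | g != 1%g) (f - rho g f) = \sum_(h : gT) Q.[rho h f].
  rewrite [RHS](bigD1 1%g) //= Defs.act1 Qf [X in _ + X]big1 ?addr0 // => h h1.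
  by rewrite Qf (bigD1 h) //= subrr mul0r.
have -> : \sum_(h : gT) Q.[rho h f] =
    \sum_(k < size Q) Q`_k * inv_val (trace (f ^+ k)).
  under eq_bigr do rewrite horner_coef.
  rewrite exchange_big; apply: eq_bigr => k _ /=; rewrite mulr_sumr.
  by apply: eq_bigr => h _; rewrite rmorphXn.
by apply: extension_sum => k _; apply/extensionM/extension_val.
Qed.

Section Radical.
Variable p : nat.
Hypothesis charK : p \in [pchar K].

Let charA : p \in [pchar A]. Proof. by rewrite pchar_lalg. Qed.

(** Only p-powers are used, since these are additive in characteristic p. *)
Definition radical (f : A) : Prop := exists m, extension (f ^+ (p ^ m)).

Let p_gt0 : (0 < p)%N. Proof. exact: prime_gt0 (pcharf_prime charA). Qed.

Lemma extension_exp f k m : (k <= m)%N -> extension (f ^+ k) -> extension (f ^+ m).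
Proof. by move=> km Ef; rewrite -(subnK km) exprD; exact: extensionM. Qed.

Lemma radical_ext f : extension f -> radical f.
Proof. by exists 0%N; rewrite expr1. Qed.

Lemma radicalX f k : radical (f ^+ k) -> radical f.
Proof.
move=> [m Ef]; exists (k * p ^ m)%N; rewrite -exprM in Ef.
by apply: extension_exp Ef; rewrite ltnW // ltn_expl // prime_gt1 // (pcharf_prime charA).
Qed.

Lemma radicalM f g : radical g -> radical (f * g).
Proof. by move=> [m Eg]; exists m; rewrite exprMn; exact: extensionM. Qed.

Lemma radicalD f g : radical f -> radical g -> radical (f + g).
Proof.
move=> [m Ef] [k Eg]; exists (maxn m k).
rewrite (@exprDn_pchar A) ?pnatX ?pnatE ?charA ?(pcharf_prime charA) //.
have -> : f ^+ (p ^ maxn m k) + g ^+ (p ^ maxn m k) =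
    \sum_(b : bool) (if b then f ^+ (p ^ maxn m k) else g ^+ (p ^ maxn m k)).
  by rewrite big_bool.
apply: extension_sum => -[] _.
  by apply: extension_exp Ef; rewrite leq_pexp2l // leq_maxl.
by apply: extension_exp Eg; rewrite leq_pexp2l // leq_maxr.
Qed.

Lemma radical0 : radical 0.
Proof. by apply: radical_ext; exists [::]; rewrite ?big_nil. Qed.

Lemma radicalN f : radical f -> radical (- f).
Proof. by rewrite -mulN1r; exact: radicalM. Qed.

Lemma radicalB f g : radical f -> radical g -> radical (f - g).
Proof. by move=> Rf Rg; apply/radicalD/radicalN. Qed.

Lemma radicalBl f g : radical (f - g) -> radical g -> radical f.
Proof. by move=> Rfg Rg; rewrite -(subrK g f); exact: radicalD. Qed.

Lemma radicalBr f g : radical (f - g) -> radical f -> radical g.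
Proof. by move=> Rfg Rf; rewrite -(subKr f g); exact: radicalB. Qed.

(** congruence of products modulo the radical *)
Lemma radical_prod I (s : seq I) (P : pred I) (F G : I -> A) :
  (forall i, P i -> radical (F i - G i)) ->
  radical (\prod_(i <- s | P i) F i - \prod_(i <- s | P i) G i).
Proof.
move=> FG; apply: (big_ind2 (fun f g => radical (f - g))) => //.
  by rewrite subrr; exact: radical0.
move=> f f' g g' Rf Rg.
have -> : f * g - f' * g' = f * (g - g') + g' * (f - f') by ring.
by apply: radicalD; exact: radicalM.
Qed.

(** A Jordan block y_1, ..., y_n with the convention y_0 = 0 *)
Section JordanBlock.
Variables (sigma : gT) (n : nat) (y : nat -> A).
Hypothesis gen_sigma : <[sigma]>%g = [set: gT].
Hypothesis ordG : #|gT| = p.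
Hypothesis n_le_p : (n <= p)%N.
Hypothesis y0 : y 0%N = 0.
Hypothesis sigma_y : forall i, (i < n)%N -> rho sigma (y i.+1) = y i.+1 + y i.
Hypothesis Jtr : forall i k, (i <= n)%N -> J (trace (y i ^+ k)).
Hypothesis Jnorm : J (norm rho (y n)).

Let sigmaXS k f : rho (sigma ^+ k.+1)%g f = rho (sigma ^+ k)%g (rho sigma f).
Proof. by rewrite expgSr Defs.actM. Qed.

Let cycleE g : exists k, g = (sigma ^+ k)%g.
Proof. by apply/cycleP; rewrite gen_sigma inE. Qed.

Let card_sigma : #[sigma]%g = p.
Proof. by rewrite /order gen_sigma cardsT. Qed.

(** sigma^(k+1) y_(i+1) = sigma^k y_(i+1) + sigma^k y_i *)
Lemma sigmaX_congr i : (i < n)%N -> (forall k, radical (rho (sigma ^+ k)%g (y i))) ->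
  forall k, radical (rho (sigma ^+ k)%g (y i.+1) - y i.+1).
Proof.
move=> i_n yi; elim=> [|k IH]; first by rewrite expg0 Defs.act1 subrr; exact: radical0.
by rewrite sigmaXS sigma_y // rmorphD /= addrAC; exact: radicalD.
Qed.

(** Once y_1, ..., y_i and their conjugates are in the radical, sigma^k moves
y_(i+2) by k y_(i+1) modulo the radical.  So the product of the
y_(i+2) - g(y_(i+2)), g <> 1, is congruent to a scalar times y_(i+1)^(p-1), and
the scalar is nonzero because g = sigma^k <> 1 means that p does not divide k. *)
Lemma block_radical_lt i : (i < n)%N ->
  forall k, radical (rho (sigma ^+ k)%g (y i)).
Proof.
elim: i => [|i IH] i_n k; first by rewrite y0 rmorph0; exact: radical0.
have yi1 := sigmaX_congr (ltnW i_n) (IH (ltnW i_n)).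
suff: radical (y i.+1) by exact: radicalBl.
have yi2 m : radical (rho (sigma ^+ m)%g (y i.+2) - y i.+2 - y i.+1 *+ m).
  elim: m => [|m IHm].
    by rewrite expg0 Defs.act1 subrr mulr0n subrr; exact: radical0.
  rewrite sigmaXS sigma_y // rmorphD /= mulrSr.
  have -> : forall a b c d e : A, a + b - c - (d + e) = (a - c - d) + (b - e).
    by move=> a b c d e; ring.
  exact: radicalD.
have /choice[e eE] := cycleE.
have := radical_ext (trace_separation (fun k => Jtr k i_n)).
have Rdiff : radical (\prod_(g : gT | g != 1%g) (y i.+2 - rho g (y i.+2))
    - \prod_(g : gT | g != 1%g) - (y i.+1 *+ e g)).
  apply: radical_prod => g _.
  have -> : forall a b c : A, a - b - - c = - (b - a - c) by move=> a b c; ring.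
  by rewrite {1}(eE g); exact: radicalN.
move/(radicalBr Rdiff).
have -> : \prod_(g : gT | g != 1%g) - (y i.+1 *+ e g) =
    (\prod_(g : gT | g != 1%g) - (e g)%:R) *: y i.+1 ^+ p.-1.
  rewrite -ordG -(cardC1 1%g) -prodr_const -scaler_prod.
  by apply: eq_bigr => g _; rewrite scaleNr scaler_nat.
set c := \prod_(g | _) _ => Ry; have c0 : c != 0.
  apply/prodf_neq0 => g g1; rewrite oppr_eq0 -(dvdn_pcharf charK) -card_sigma.
  apply: contra g1 => /dvdnP[q eq]; rewrite (eE g) eq mulnC expgM.
  by rewrite expg_order expg1n.
apply: (@radicalX _ p.-1); rewrite -[y i.+1 ^+ _](scalerK c0) -mulr_algl.
exact: radicalM.
Qed.

Lemma block_radical i : (i <= n)%N -> radical (y i).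
Proof.
rewrite leq_eqVlt => /predU1P[->|i_n]; last first.
  by have := block_radical_lt i_n 0; rewrite expg0 Defs.act1.
have [n0|n_gt0] := posnP n; first by rewrite n0 y0; exact: radical0.
have Rdiff : radical (\prod_(g : gT) rho g (y n) - \prod_(g : gT) y n).
  apply: radical_prod => g _; have [k ->] := cycleE g.
  rewrite -(prednK n_gt0); apply: sigmaX_congr; first by rewrite prednK.
  by apply: block_radical_lt; rewrite prednK.
have := radicalBr Rdiff (radical_ext (extension_val Jnorm)).
by rewrite prodr_const; exact: radicalX.
Qed.

End JordanBlock.
End Radical.
End Transfer.

(** * Graded modules over the invariant ring *)

Lemma closed_field_infinite (K : closedFieldType) (s : seq K) : exists c, c \notin s.
Proof.
pose q := \prod_(a <- 0 :: s) ('X - a%:P) + 1.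
have szp : size (\prod_(a <- 0 :: s) ('X - a%:P)) = (size s).+2.
  by rewrite size_prod_XsubC.
have /closed_rootP[c qc] : size q != 1 by rewrite size_polyDl szp ?size_poly1.
exists c; apply/negP => cs; move: qc; rewrite /root hornerD hornerC horner_prod.
by rewrite (big_rem c) ?inE ?cs ?orbT //= hornerXsubC subrr mul0r add0r oner_eq0.
Qed.

Section Nakayama.
Variables (R : comNzRingType) (gr : nat -> {pred R}) (M : lmodType R).
Variable Mgr : nat -> {pred M}.
Hypothesis M_graded : graded_module gr Mgr.
Hypothesis M_nonzero : exists x : M, x != 0.

(** Graded Nakayama: a nonzero u of the lowest degree d0 occurring in M is not in
(s)M, whose elements have no component of degree d0. *)
Lemma addms_proper s :
  (forall r, r \in s -> exists2 d, (0 < d)%N & r \in gr d) ->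
  exists x, ~ addms (fun x : M => x = 0) s x.
Proof.
move=> s_pos; have [[Mz Msum Muniq] Mmul] := M_graded.
have Mgr0 e : 0 \in Mgr e by case: (Mz e).
have MgrB e x y : x \in Mgr e -> y \in Mgr e -> x - y \in Mgr e by case: (Mz e) => _; exact.
have [d0 [[u Mu u0] d0min]] : exists d0, (exists2 u, u \in Mgr d0 & u != 0) /\
    forall e x, (e < d0)%N -> x \in Mgr e -> x = 0.
  have Pex : exists d, `[< exists2 u, u \in Mgr d & u != 0 >].
    have [x x0] := M_nonzero; have [n [c cM xE]] := Msum x.
    apply: contrapT => noP; move/eqP: x0; apply; rewrite xE big1 // => i _.
    apply: contrapT => ci; apply: noP; exists i; apply/asboolP.
    by exists (c i) => //; exact/eqP.
  exists (ex_minn Pex); case: ex_minnP => d /asboolP Pd dmin; split=> // e x ed Mx.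
  apply/eqP; apply: contraTT ed => x0; rewrite -leqNgt; apply: dmin.
  by apply/asboolP; exists x.
(* H: sums of homogeneous elements whose component of degree d0 vanishes; the
   coefficients beyond n vanish so that sums of two such can be padded. *)
pose H x := exists n (c : nat -> M), [/\ forall e, c e \in Mgr e, c d0 = 0,
  forall e, (n <= e)%N -> c e = 0 & x = \sum_(e < n) c e].
have widen n m (c : nat -> M) : (forall e, (n <= e)%N -> c e = 0) -> (n <= m)%N ->
    \sum_(e < n) c e = \sum_(e < m) c e.
  move=> c0 nm; rewrite (big_ord_widen m c nm) big_mkcond.
  by apply: eq_bigr => e _; case: ltnP => // /c0.
have HB : stable (fun _ => False) H.
  split=> //; first by exists 0%N, (fun=> 0); split=> //; rewrite big_ord0.
  move=> _ _ [n [c [cM cd cn ->]]] [m [c' [c'M c'd c'm ->]]].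
  exists (maxn n m), (fun e => c e - c' e); split=> [e||e|].
  - exact: MgrB.
  - by rewrite cd c'd subrr.
  - by rewrite geq_max => /andP[/cn-> /c'm->]; rewrite subrr.
  - by rewrite sumrB (widen _ _ _ cn (leq_maxl n m)) (widen _ _ _ c'm (leq_maxr n m)).
have Hr r x : r \in s -> H (r *: x).
  move=> /s_pos[d d_gt0 rd]; have [n [c cM ->]] := Msum x.
  pose c' e := if (d <= e < d + n)%N then r *: c (e - d)%N else 0.
  exists (d + n)%N, c'; split=> [e||e|].
  - rewrite /c'; case: ifP => // /andP[de _].
    by rewrite -{2}(subnKC de); exact: Mmul.
  - rewrite /c'; case: ifP => // /andP[dd _].
    rewrite (d0min (d0 - d)%N (c (d0 - d)%N)) ?scaler0 //.
    by rewrite ltn_subrL d_gt0 (leq_trans d_gt0).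
  - by rewrite /c' ltnNge => ->; rewrite andbF.
  - rewrite big_split_ord /= [X in _ = X + _]big1 ?add0r => [|i _]; last first.
      by rewrite /c' leqNgt ltn_ord.
    rewrite scaler_sumr; apply: eq_bigr => i _.
    by rewrite /c' leq_addr ltn_add2l ltn_ord addKn.
exists u => /addmsP[y /subr0_eq uE].
have [n [c [cM cd cn uE']]] : H u.
  rewrite uE; apply: (stable_sum HB) => i _; apply: Hr; exact: mem_nth.
pose b e := c e - (if e == d0 then u else 0).
have bM e : b e \in Mgr e by rewrite /b; apply: MgrB => //; case: eqP => [->|_].
have dm : (d0 < maxn n d0.+1)%N by rewrite leq_max ltnSn orbT.
have bsum : \sum_(e < maxn n d0.+1) b e = 0.
  rewrite sumrB -(widen _ _ _ cn (leq_maxl n d0.+1)) -uE'.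
  rewrite (bigD1 (Ordinal dm)) //= eqxx big1 ?addr0 ?subrr // => i.
  by rewrite -val_eqE /= => /negPf ->.
have := Muniq _ b bM bsum d0 dm.
by rewrite /b eqxx cd sub0r => /eqP; rewrite oppr_eq0 (negPf u0).
Qed.

End Nakayama.

Lemma transfer_trace (K : fieldType) (A : comAlgType K) (gT : finGroupType)
    (rho : alg_action gT A) p sigma f :
  <[sigma]>%g = [set: gT] -> #|gT| = p -> transfer rho p sigma f = inv_val (trace rho f).
Proof.
move=> gen ordG; have card_sigma : #[sigma]%g = p by rewrite /order gen cardsT.
rewrite /transfer /= [RHS](reindex (fun i : 'I_p => sigma ^+ i)%g) //.
apply: onW_bij; apply: inj_card_bij; last by rewrite card_ord ordG.
move=> i j /eqP; rewrite eq_expg_mod_order card_sigma !modn_small //.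
by move/eqP/val_inj.
Qed.

Lemma addms_scale (R : comNzRingType) (M : lmodType R) (A : M -> Prop) s r m :
  stable full A -> r \in s -> addms A s (r *: m).
Proof.
elim: s A => //= z s IH A sA; rewrite inE => /predU1P[->|rs].
  exact/sub_addms/addm_scale.
by apply: IH => //; exact: addm_submod.
Qed.

Section GradedInvariants.
Variables (K : fieldType) (l : nat) (n : 'I_l -> nat) (gT : finGroupType).
Variable rho : alg_action gT {mpoly K[nvars n]}.
Local Notation R := (inv_ring rho).
Local Notation gr := (inv_grading rho).
Local Notation iota := (GRing.in_alg R : {rmorphism K -> R}).

(** An element of degree 0 in R_+ is 0, and 0 also has degree 1. *)
Lemma pos_homogP (r : R) :
  pos_homog gr r <-> exists2 d, (0 < d)%N & r \in gr d.
Proof.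
split=> [[[[|d] rd] /asboolP[m [c cd rE]]]|[d d_gt0 rd]].
- suff r0 : inv_val r = 0 by exists 1%N; rewrite // unfold_in /inv_grading r0 dhomog0.
  apply/mpolyP => k; rewrite mcoeff0; have [k0|k0] := eqVneq (mdeg k) 0%N; last first.
    exact: (dhomog_nemf_coeff rd).
  rewrite rE inv_val_sum raddf_sum big_nat big1 // => e /andP[e_gt0 _].
  have ke : mdeg k != e by rewrite k0 eq_sym -lt0n.
  exact: (dhomog_nemf_coeff (cd e) ke).
- by exists d.+1.
split; first by exists d.
apply/asboolP; exists d.+1; exists (fun e => if e == d then r else 0) => [e|].
  case: eqP => [->|_] //; exact: dhomog0.
rewrite big_nat_recr //= eqxx big_nat big1 ?add0r // => e /andP[_ ed].
by rewrite ltn_eqF.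
Qed.

Lemma ideal_pencil (I : R -> Prop) :
  stable full (I : R^o -> Prop) ->
  pencil_closed iota (fun r => pos_homog gr r /\ I r).
Proof.
move=> sI z y [/pos_homogP[d d_gt0 zd] Iz] [/pos_homogP[e e_gt0 ye] Iy].
have IX w k : (0 < k)%N -> I w -> I (w ^+ k).
  by case: k => // k _ Iw; rewrite exprSr; exact: (stableZ sI (s := w ^+ k)).
exists e, d => c; split; last first.
  apply: (stableD sI); first exact: IX.
  by apply: (stableZ sI (s := iota c)) => //; exact: IX.
apply/pos_homogP; exists (d * e)%N; first by rewrite muln_gt0 d_gt0.
have valE : inv_val (z ^+ e + iota c * y ^+ d) = inv_val z ^+ e + c *: inv_val y ^+ d.
  by rewrite mulr_algl -!inv_valX.
rewrite unfold_in /inv_grading valE.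
by apply: dhomogD; [|apply: dhomogZ; rewrite mulnC]; exact: dhomogMn.
Qed.

Lemma pos_homog_pencil : pencil_closed iota (pos_homog gr).
Proof.
have sfull : stable full (full : R^o -> Prop) by split.
move=> z y Ez Ey; have [a [b Eab]] := ideal_pencil sfull (conj Ez I) (conj Ey I).
by exists a, b => c; case: (Eab c).
Qed.

End GradedInvariants.

(** * The transfer ideal of a sum of Jordan blocks *)

Section Variables.
Variables (K : fieldType) (l : nat) (n : 'I_l -> nat).

Lemma xvar_homog i j : xvar K n i j \is 1.-homog.
Proof.
rewrite /xvar; case: insubP => [k _ _|_]; last exact: dhomog0.
by rewrite dhomogX; apply/eqP; exact: mdeg1.
Qed.

Lemma xvar_surj (v : 'I_(nvars n)) :
  exists i j, (0 < i <= n j)%N /\ 'X_v = xvar K n i j.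
Proof.
case E : (enum_val v) => [j k]; exists k.+1, j; split; first by rewrite ltn_ord.
rewrite /xvar /= valK -[v in LHS]enum_valK; congr 'X_(enum_rank _).
by rewrite E.
Qed.

End Variables.

Section VectorInvariants.
Variables (K : fieldType) (p : nat).
Hypothesis charK : p \in [pchar K].
Variables (gT : finGroupType) (sigma : gT).
Hypothesis gen_sigma : <[sigma]>%g = [set: gT].
Hypothesis ordG : #|gT| = p.
Variables (l : nat) (n : 'I_l -> nat).
Hypothesis n_bound : forall j, (1 < n j <= p)%N.
Variable rho : alg_action gT {mpoly K[nvars n]}.
Hypothesis rho1 : forall j, rho sigma (xvar K n 1 j) = xvar K n 1 j.
Hypothesis rhoS : forall i j, (1 < i <= n j)%N ->
  rho sigma (xvar K n i j) = xvar K n i j + xvar K n i.-1 j.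
Local Notation R := (inv_ring rho).
Local Notation gr := (inv_grading rho).
Local Notation I := (transfer_ideal rho p sigma).

(** x_{i,j} for i >= 1, extended by x_{0,j} = 0 so that sigma acts uniformly *)
Definition jordan_var j i := if i is 0 then 0 else xvar K n i j.

Lemma sigma_jordan_var j i : (i < n j)%N ->
  rho sigma (jordan_var j i.+1) = jordan_var j i.+1 + jordan_var j i.
Proof.
case: i => [|i] i_n /=; first by rewrite rho1 addr0.
by rewrite rhoS.
Qed.

Lemma jordan_var_homog j i g : (i <= n j)%N -> rho g (jordan_var j i) \is 1.-homog.
Proof.
have /cycleP[k ->] : g \in <[sigma]>%g by rewrite gen_sigma inE.
elim: k i => [|k IH] i i_n.
  by rewrite expg0 Defs.act1; case: i i_n => [|i] _; rewrite ?dhomog0 ?xvar_homog.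
case: i i_n => [|i] i_n; first by rewrite rmorph0 dhomog0.
rewrite expgSr Defs.actM sigma_jordan_var // rmorphD.
by apply: dhomogD; apply: IH => //; exact: ltnW.
Qed.

Lemma transfer_ideal_stable : stable full ((fun r => r \in I) : R^o -> Prop).
Proof.
split.
- apply/asboolP; exists 0; rewrite (transfer_trace _ _ gen_sigma ordG) /=.
  by rewrite big1 // => g _; rewrite rmorph0.
- move=> r s /asboolP[f rf] /asboolP[g sg]; apply/asboolP; exists (f - g).
  rewrite -[LHS]/(inv_val r - inv_val s) rf sg /transfer -sumrB.
  by apply: eq_bigr => i _; rewrite rmorphB.
- move=> r s _ /asboolP[f sf]; apply/asboolP; exists (inv_val r * f).
  rewrite -[LHS]/(inv_val r * inv_val s) sf /transfer mulr_sumr.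
  by apply: eq_bigr => i _; rewrite rmorphM /= inv_val_act.
Qed.

(** The only power whose trace would have degree 0 is 1, whose trace is p = 0. *)
Lemma trace_jordan_var j i k : (i <= n j)%N -> trace rho (jordan_var j i ^+ k) != 0 ->
  pos_homog gr (trace rho (jordan_var j i ^+ k)) /\ trace rho (jordan_var j i ^+ k) \in I.
Proof.
move=> i_n tr0; split; last first.
  by apply/asboolP; exists (jordan_var j i ^+ k); rewrite (transfer_trace _ _ gen_sigma ordG).
apply/pos_homogP; exists k.
  rewrite lt0n; apply: contra tr0 => /eqP ->; apply/eqP/inv_val_inj => /=.
  under eq_bigr do rewrite expr0 rmorph1.
  rewrite sumr_const cardT -cardE ordG; apply: pcharf0.
  by rewrite pchar_lalg.
rewrite unfold_in /inv_grading /=; apply: rpred_sum => g _.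
by have := dhomogMn k (jordan_var_homog g i_n); rewrite mul1n -rmorphXn.
Qed.

(** R_+ is contained in the radical of every ideal that contains the homogeneous
elements of positive degree of the transfer ideal and the top norms. *)
Lemma transfer_norm_radical (J : R^o -> Prop) : stable full J ->
  (forall r, pos_homog gr r -> r \in I -> J r) ->
  (forall j, J (norm rho (xvar K n (n j) j))) ->
  forall r, pos_homog gr r -> exists m, J (r ^+ m).
Proof.
move=> sJ JI Jnorm r /pos_homogP[d d_gt0 rd].
have Xrad v : radical J p 'X_v.
  have [[|i] [j [/andP[// _ i_n] ->]]] := xvar_surj K v.
  rewrite -[xvar _ _ _ _]/(jordan_var j i.+1).
  apply: (block_radical charK (sigma := sigma) (n := n j)) => //.
  - exact: sigma_jordan_var.
  - move=> i' k i'_n; have [->|tr0] := eqVneq (trace rho (jordan_var j i' ^+ k)) 0.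
      exact: (stable0 sJ).
    by have [tr_pos trI] := trace_jordan_var i'_n tr0; exact: JI.
  - by have := Jnorm j; case/andP: (n_bound j); case: (n j).
have [m rm] : radical J p (inv_val r).
  rewrite [inv_val r]mpolyE big_seq.
  apply: (big_ind (radical J p)) => [|f g|m msup]; first exact: radical0.
    exact: radicalD.
  rewrite -mul_mpolyC; apply: radicalM.
  have [v mv] : exists v, m v != 0%N.
    apply/existsP; rewrite -negb_forall; apply: contraL d_gt0 => /forallP m0.
    have -> : d = 0%N; last by [].
    rewrite -(dhomog_mf rd msup) /= mdegE big1 // => v _; exact/eqP.
  rewrite mpolyXE_id (bigD1 v) //= mulrC -(prednK (n := m v)) ?lt0n // exprSr mulrA.
  exact: radicalM.
exists (p ^ m * #|gT|)%N; rewrite exprM; apply: extension_contract => //.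
by rewrite inv_valX.
Qed.

End VectorInvariants.

Unset Implicit Arguments.
Set Strict Implicit.
Set Printing Implicit Defensive.

Theorem proposition13
    (K : closedFieldType) (p : nat) (charK : p \in [pchar K])
    (gT : finGroupType) (sigma : gT)
    (gen_sigma : <[sigma]>%g = [set: gT]) (ordG : #|gT| = p)
    (l : nat) (l_gt0 : (0 < l)%N)
    (n : 'I_l -> nat) (n_bound : forall j, (1 < n j <= p)%N)
    (rho : alg_action gT {mpoly K[nvars n]})
    (rho1 : forall j, rho sigma (xvar K n 1 j) = xvar K n 1 j)
    (rhoS : forall i j, (1 < i <= n j)%N ->
       rho sigma (xvar K n i j) = xvar K n i j + xvar K n i.-1 j)
    (M : lmodType (inv_ring rho)) (Mgr : nat -> {pred M})
    (M_graded : graded_module (inv_grading rho) Mgr)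
    (M_fingen : fin_gen M)
    (M_nonzero : exists x : M, x != 0)
    (norms_regular : regular_seq (inv_grading rho) M
       [seq norm rho (xvar K n (n j) j) | j : 'I_l]) :
  exists depthM gradeI : nat,
    [/\ is_depth (inv_grading rho) M depthM,
        is_grade (inv_grading rho) (transfer_ideal rho p sigma)
          (seq_quot M [seq norm rho (xvar K n (n j) j) | j : 'I_l]) gradeI
      & depthM = (gradeI + l)%N].
Proof.
set a := [seq norm rho (xvar K n (n j) j) | j : 'I_l] in norms_regular *.
have noR := inv_ring_noeth (rho := rho) (@mpoly_gen K (nvars n)).
have noM := fin_gen_noeth noR M_fingen.
have sI := transfer_ideal_stable gen_sigma ordG rho.
have M0 := zero_submod M.
have [|s rs|||dM [gI]] := depth_grade (@closed_field_infinite K) noR noM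
  (pos_homog_pencil (rho := rho)) (ideal_pencil sI) _ _ (a := a).
- split; last exact: (stable0 sI).
  by apply/pos_homogP; exists 1%N; rewrite // unfold_in /inv_grading dhomog0.
- have /rseqP[s_pos _] := rs.
  by apply: (addms_proper M_graded M_nonzero) => r /s_pos/pos_homogP.
- by apply/(regular_seqP (f := id)) => // v; exists v.
(* The annihilator of u modulo A is an ideal J as in transfer_norm_radical. *)
- move=> A u sA aA IA y Ey.
  apply: (transfer_norm_radical charK gen_sigma ordG n_bound rho1 rhoS _ _ _ Ey (J := fun r => A (r *: u))).
  + split; first by rewrite scale0r; exact: (stable0 sA).
      by move=> r s Ar As; rewrite scalerBl; exact: (stableB sA).
    by move=> r s _ As; rewrite -scalerA; exact: submodZ.
  + by move=> r Er Ir; exact: IA.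
  + by move=> j; apply/aA/addms_scale; rewrite // image_f.
by rewrite size_image card_ord => H; exists dM, gI.
Qed.
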